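(* Let $\phi_1, \ldots, \phi_m : \mathbb{R}^n \to \mathbb{C}$ be functions on Euclidean space $\mathbb{R}^n$ endowed with the standard Gaussian probability measure, and let $r \geq 2$ and $c \geq 1$ be integers. Assume that: (1) each $\phi_i$ is 1-Lipschitz in the $\ell^1$ metric of $\mathbb{R}^n$, that is, $|\phi_i(x_1, \ldots, x_n) - \phi_i(y_1, \ldots, y_n)| \leq \sum_{j=1}^n |x_j - y_j|$ for all $x, y \in \mathbb{R}^n$; (2) each $\phi_i$ depends on at most $r$ coordinates; (3) for every $j = 1, \ldots, n$ there are at most $c$ functions $\phi_i$ that depend on the coordinate $x_j$. Let $f = \sum_{i=1}^m \phi_i$ and let $\lambda \in \mathbb{C}$ satisfy $$|\lambda| < \frac{1}{6c\sqrt{r-1}}.$$ Then $$\mathbf{E}\, e^{\lambda f} \neq 0.$$ Moreover, if, additionally, for some $L > 0$ we have $|\phi_i(x)| \leq L$ for all $x \in \mathbb{R}^n$ and all $i = 1, \ldots, m$, then $$e^{|\lambda| m L} \geq \left|\mathbf{E}\, e^{\lambda f}\right| \geq e^{-|\lambda| m L}\, \exp\left\{-\frac{\pi^2 n}{32 r}\right\}.$$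
   Context: $\mathbf{E}$ denotes expectation with respect to the standard Gaussian probability measure on $\mathbb{R}^n$, with density $(2\pi)^{-n/2}\exp\{-\frac12(x_1^2 + \cdots + x_n^2)\}$. Conditions (2) and (3) mean that there are subsets $J_1, \ldots, J_m \subset \{1, \ldots, n\}$ with $|J_i| \leq r$ for all $i$ and $|\{i : j \in J_i\}| \leq c$ for all $j$, such that $\phi_i(x) = \phi_i(y)$ whenever $x_j = y_j$ for all $j \in J_i$. *)

(* Defs.v *)
From HB Require Import structures.
From mathcomp Require Import all_boot all_order all_algebra.
From mathcomp Require Import complex.
From mathcomp Require Import all_classical all_reals all_analysis.
From mathcomp Require Import measurable_realfun.

Set Implicit Arguments.
Unset Strict Implicit.
Unset Printing Implicit Defensive.
Import Order.TTheory GRing.Theory Num.Theory.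
Import numFieldNormedType.Exports.

Local Open Scope classical_set_scope.
Local Open Scope ring_scope.

Section ConsMeasure.
Context d (T : measurableType d) (R : realType) (n : nat).
Variables (mu : {sigma_finite_measure set T -> \bar R})
  (nu : {sigma_finite_measure set (n.-tuple T) -> \bar R}).

Definition tcons (p : T * n.-tuple T) : n.+1.-tuple T := [tuple of p.1 :: p.2].

Definition tuncons (t : n.+1.-tuple T) : T * n.-tuple T :=
  (thead t, [tuple of behead t]).

Lemma measurable_tcons : measurable_fun setT tcons.
Proof. exact: measurable_cons. Qed.

Lemma measurable_tuncons : measurable_fun setT tuncons.
Proof.
apply/measurable_fun_pairP; split; last exact: measurable_behead.
exact: measurable_tnth.
Qed.

Lemma tconsK : cancel tcons tuncons.
Proof.
by move=> [x t]; rewrite /tuncons /tcons theadE; congr pair; apply: val_inj.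
Qed.

Lemma tunconsK : cancel tuncons tcons.
Proof. by move=> t; rewrite [RHS]tuple_eta. Qed.

Definition cons_measure : set (n.+1.-tuple T) -> \bar R :=
  pushforward (mu \x nu)%E tcons.

Let cons_measure0 : cons_measure set0 = 0%E.
Proof. by rewrite /cons_measure /pushforward preimage_set0 measure0. Qed.

Let cons_measure_ge0 A : (0 <= cons_measure A)%E.
Proof. by apply: measure_ge0; exact: measurable_tcons. Qed.

Let cons_measure_sigma_additive : semi_sigma_additive cons_measure.
Proof.
by apply: measure_semi_sigma_additive; exact: measurable_tcons.
Qed.

HB.instance Definition _ := isMeasure.Build _ _ _ cons_measure
  cons_measure0 cons_measure_ge0 cons_measure_sigma_additive.

Let cons_measure_sigma_finite : sigma_finite setT cons_measure.
Proof.
have /sigma_finiteP[F [TF ndF Foo]] := sigma_finiteT mu.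
have /sigma_finiteP[G [TG ndG Goo]] := sigma_finiteT nu.
exists (fun k => tuncons @^-1` (F k `*` G k)).
  apply/seteqP; split => // t _.
  have [i _ Fi] : (\bigcup_i F i) (tuncons t).1 by rewrite -TF.
  have [j _ Gj] : (\bigcup_i G i) (tuncons t).2 by rewrite -TG.
  exists (maxn i j) => //; split.
    by move: Fi; exact/subsetPset/ndF/leq_maxl.
  by move: Gj; exact/subsetPset/ndG/leq_maxr.
move=> k; have [mF Fk] := Foo k; have [mG Gk] := Goo k; split.
  rewrite -[X in measurable X]setTI; apply: measurable_tuncons => //.
  exact: measurableX.
rewrite /cons_measure /pushforward -comp_preimage.
rewrite (_ : tuncons \o tcons = id) ?preimage_id; last first.
  by apply/funext => p; exact: tconsK.
by rewrite product_measure1E// lte_mul_pinfty// ge0_fin_numE.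
Qed.

HB.instance Definition _ := Measure_isSigmaFinite.Build _ _ _ cons_measure
  cons_measure_sigma_finite.

End ConsMeasure.

(* n-fold product of the Lebesgue measure; R^0 is a single point of mass 1 *)
Fixpoint lebesgue_tuple (R : realType) (n : nat) :
    {sigma_finite_measure set (n.-tuple (measurableTypeR R)) -> \bar R} :=
  match n with
  | 0 => \d_[tuple]
  | n'.+1 => cons_measure lebesgue_measure (lebesgue_tuple R n')
  end.

Definition gauss_pdf (R : realType) (n : nat) (x : n.-tuple R) : R :=
  (2 * pi) `^ (- (n%:R / 2)) *
  expR (- (2^-1 * \sum_(j < n) tnth x j ^+ 2)).

Definition gauss_prob (R : realType) (n : nat) : set (n.-tuple R) -> \bar R :=
  fun A => (\int[lebesgue_tuple R n]_(x in A) (gauss_pdf x)%:E)%E.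

Section GaussProb.
Context (R : realType).

Lemma measurable_gauss_pdf n : measurable_fun setT (@gauss_pdf R n).
Proof.
apply: measurable_funM => //; apply: measurableT_comp => //.
apply: measurableT_comp => //; apply: measurable_funM => //.
apply: measurable_sum => j; apply: measurable_funX; exact: measurable_tnth.
Qed.

Lemma gauss_pdf_ge0 n (x : n.-tuple R) : 0 <= gauss_pdf x.
Proof. by rewrite mulr_ge0 ?powR_ge0 ?expR_ge0. Qed.

Lemma gauss_pdf_cons n (x : R) (t : n.-tuple R) :
  gauss_pdf (tcons (x, t)) = normal_pdf 0 1 x * gauss_pdf t.
Proof.
rewrite /gauss_pdf normal_pdfE ?oner_eq0// /normal_peak /normal_fun.
rewrite expr1n mul1r subr0 big_ord_recl /= /tcons /= tnth0.
under eq_bigr do rewrite tnthS.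
rewrite mulrACA -expRD; congr (_ * expR _); last first.
  by rewrite mulrDr opprD mulNr [2^-1 * _]mulrC.
have pi2_neq0 : (2 * pi : R) != 0.
  by rewrite mulf_neq0 ?pnatr_eq0// gt_eqF// pi_gt0.
have -> : Num.sqrt (pi *+ 2) = (2 * pi : R) `^ 2^-1.
  by rewrite powR12_sqrt ?mulr_ge0 ?pi_ge0// mulr_natl.
rewrite -powRN -powRD.
  by congr powR; rewrite -opprD -[n.+1]add1n natrD mulrDl mul1r.
by rewrite pi2_neq0 implybT.
Qed.

Lemma integral_gauss_pdf n :
  (\int[lebesgue_tuple R n]_x (gauss_pdf x)%:E = 1)%E.
Proof.
elim: n => [|n IH].
  rewrite /= integral_dirac//; last first.
    by apply/measurable_EFinP; exact: measurable_gauss_pdf.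
  rewrite diracT mul1e /gauss_pdf big_ord0 mul0r mulr0 oppr0 powRr0 expR0.
  by rewrite mulr1.
rewrite /= /cons_measure ge0_integral_pushforward//; last 3 first.
- exact: measurable_tcons.
- by apply/measurable_EFinP; exact: measurable_gauss_pdf.
- by move=> x _; rewrite lee_fin gauss_pdf_ge0.
rewrite preimage_setT fubini_tonelli1//=; last 2 first.
- apply/measurable_EFinP.
  apply: (measurableT_comp (@measurable_gauss_pdf n.+1)).
  exact: measurable_tcons.
- by move=> x; rewrite lee_fin gauss_pdf_ge0.
rewrite -(@integral_normal_pdf R 0 1); apply: eq_integral => x _.
rewrite /fubini_F /=; under eq_integral do rewrite gauss_pdf_cons EFinM.
rewrite ge0_integralZl//.
- by rewrite IH mule1.
- by apply/measurable_EFinP; exact: measurable_gauss_pdf.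
- by move=> t _; rewrite lee_fin gauss_pdf_ge0.
- by rewrite lee_fin normal_pdf_ge0.
Qed.

Variable n : nat.
Local Notation P := (@gauss_prob R n).

Let gauss_prob0 : P set0 = 0%E.
Proof. by rewrite /gauss_prob integral_set0. Qed.

Let gauss_prob_ge0 A : (0 <= P A)%E.
Proof. by apply: integral_ge0 => x _; rewrite lee_fin gauss_pdf_ge0. Qed.

Let gauss_prob_sigma_additive : semi_sigma_additive P.
Proof.
move=> /= A mA tA mUA; rewrite /gauss_prob ge0_integral_bigcup//=; last 2 first.
- apply: measurable_funTS; apply/measurable_EFinP; exact: measurable_gauss_pdf.
- by move=> x _; rewrite lee_fin gauss_pdf_ge0.
apply: is_cvg_ereal_nneg_natsum_cond => k _ _.
by apply: integral_ge0 => x _; rewrite lee_fin gauss_pdf_ge0.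
Qed.

HB.instance Definition _ := isMeasure.Build _ _ _ P
  gauss_prob0 gauss_prob_ge0 gauss_prob_sigma_additive.

Let gauss_prob_setT : P setT = 1%E.
Proof. exact: integral_gauss_pdf. Qed.

HB.instance Definition _ := @Measure_isProbability.Build _ _ R P
  gauss_prob_setT.
End GaussProb.

Definition cexp (R : realType) (z : R[i]) : R[i] :=
  Complex (expR (complex.Re z) * cos (complex.Im z))
          (expR (complex.Re z) * sin (complex.Im z)).

(* Re and Im are integrated separately; [fine] sends infinite values to 0, so
   this is the expectation only for integrable g. *)
Definition gauss_expectation (R : realType) (n : nat)
    (g : n.-tuple R -> R[i]) : R[i] :=
  Complex (fine 'E_(@gauss_prob R n)[fun x => complex.Re (g x)])
          (fine 'E_(@gauss_prob R n)[fun x => complex.Im (g x)]).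

Definition depends_only_on (R : realType) (n : nat) (J : {set 'I_n})
    (g : n.-tuple R -> R[i]) : Prop :=
  forall x y : n.-tuple R,
    (forall j, j \in J -> tnth x j = tnth y j) -> g x = g y.

(* Main.v *)
(* For a set S of coordinates let z_S be the integral of H = exp(lambda f) over
   the coordinates in S, a function of the others.  Write d = r - 1.  By
   induction on S one shows that z_S never vanishes and that, for g bounded by 1
   and depending on k coordinates of S (and on those outside S), the integral of
   g H is at most A^-k |z_S| with A = 1 - 1/(9d).

   Move a coordinate x_j outside S by a small h.  To first order z_S changes by
   the sum, over the at most c functions phi_i depending on x_j, of the
   integrals of lambda (phi_i(x_j + h) - phi_i(x_j)) H, in which the increment
   is bounded by h and depends on at most d coordinates of S.  Hence the
   relative change is at most h |lambda| c A^-d <= kappa h with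
   kappa = 1/(5 sqrt d), and subdividing a long segment shows that log |z_S| and
   the argument of z_S are kappa-Lipschitz in x_j.  Against the Gaussian weight
   in x_j there is then little cancellation: integrating x_j out loses at most
   the factor A, which is the induction step.  Taking for g the conjugate phase
   of H gives |E H| >= A^n E |H|. *)
Require Import Defs.
From HB Require Import structures.
From mathcomp Require Import all_boot all_order all_algebra.
From mathcomp Require Import complex.
From mathcomp Require Import all_classical all_reals all_analysis.
From mathcomp Require Import measurable_realfun ring lra.

Set Implicit Arguments.
Unset Strict Implicit.
Unset Printing Implicit Defensive.
Import Order.TTheory GRing.Theory Num.Theory.
Import Normc.

Local Open Scope ring_scope.

(** * Gaussian measure *)

Section Density.
Context d (T : measurableType d) (R : realType).
Variables (mu nu : {measure set T -> \bar R}) (p : T -> R).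
Hypotheses (mp : measurable_fun setT p) (p0 : forall x, 0 <= p x).
Hypothesis nuE :
  forall A, measurable A -> nu A = (\int[mu]_(x in A) (p x)%:E)%E.

Local Open Scope ereal_scope.

Import HBNNSimple.

(** [nuE] settles indicators; linearity over the level sets of [g n] extends this to simple
    functions, and monotone convergence, applied on both sides, to [f]. *)
Lemma ge0_integral_density (f : T -> \bar R) :
  measurable_fun setT f -> (forall x, 0 <= f x) ->
  \int[nu]_x f x = \int[mu]_x (f x * (p x)%:E).
Proof.
move=> mf f0; pose g := nnsfun_approx measurableT mf.
have mpE : measurable_fun setT (EFin \o p) by exact/measurable_EFinP.
transitivity (limn (fun n => \int[nu]_x (g n x)%:E)).
  rewrite -monotone_convergence//.
  - by apply: eq_integral => x _; apply/esym/cvg_lim => //;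
      exact: cvg_nnsfun_approx.
  - by move=> n; exact/measurable_EFinP.
  - by move=> n x _; rewrite lee_fin.
  - by move=> x _ a b ab; rewrite lee_fin; exact/lefP/nd_nnsfun_approx.
transitivity (limn (fun n => \int[mu]_x ((g n x)%:E * (p x)%:E))); last first.
  rewrite -monotone_convergence//.
  - apply: eq_integral => x _; apply/cvg_lim => //.
    apply: cvgeZr => //.
    by apply: cvg_nnsfun_approx.
  - by move=> n; apply: emeasurable_funM => //; exact/measurable_EFinP.
  - by move=> n x _; rewrite mule_ge0// lee_fin.
  - move=> x _ a b ab; rewrite lee_wpmul2r// lee_fin//.
    exact/lefP/nd_nnsfun_approx.
congr (limn _); apply/funext => n.
have indic m r :
  measurable_fun setT (fun x => (r * \1_(g m @^-1` [set r]) x)%:E).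
  by apply/measurable_EFinP; exact: measurable_funM.
transitivity (\int[nu]_x
   (\sum_(y \in range (g n)) (y * \1_(g n @^-1` [set y]) x)%:E)).
  by apply: eq_integral => t tE; rewrite /= fimfunE -fsumEFin.
rewrite ge0_integral_fsum//; last by move=> m y Ey; exact: nnfun_muleindic_ge0.
transitivity (\int[mu]_x (\sum_(y \in range (g n))
    (y * \1_(g n @^-1` [set y]) x)%:E * (p x)%:E)); last first.
  under [RHS]eq_integral => x xE.
    rewrite fimfunE -fsumEFin// ge0_mule_fsuml => [|y];
      last exact: nnfun_muleindic_ge0.
    over.
  by [].
rewrite ge0_integral_fsum//; last 2 first.
  - by move=> y; apply: emeasurable_funM.
  - move=> m y Ey; apply: mule_ge0; last by rewrite lee_fin.
    exact: nnfun_muleindic_ge0.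
apply: eq_fsbigr => r rhn.
under eq_integral do rewrite EFinM.
rewrite integralZl_indic_nnsfun => //.
under [RHS]eq_integral do rewrite EFinM -muleA.
have mgr : measurable (g n @^-1` [set r]).
  by rewrite -[X in measurable X]setTI; exact: measurable_funP.
have r0 : (0 <= r)%R by move: rhn; rewrite inE => -[x _ <-].
rewrite ge0_integralZl//.
- congr (_ * _); rewrite integral_indic// setIT nuE//.
  rewrite [LHS]integral_mkcond; apply: eq_integral => x _.
  by rewrite epatch_indic muleC.
- apply: emeasurable_funM => //; exact/measurable_EFinP.
- by move=> x _; rewrite mule_ge0 ?lee_fin.
Qed.
End Density.

Section Gauss.
Context (R : realType).

Local Open Scope classical_set_scope.
Local Open Scope ring_scope.

Definition gauss1 := @normal_prob R 0 1.
HB.instance Definition _ := Probability.on gauss1.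

Local Open Scope ereal_scope.

Lemma ge0_integral_gauss1 (f : R -> \bar R) :
  measurable_fun setT f -> (forall x, 0 <= f x) ->
  \int[gauss1]_x f x =
  \int[lebesgue_measure]_x (f x * (normal_pdf 0 1 x)%:E).
Proof.
apply: (@ge0_integral_density _ _ R lebesgue_measure gauss1
  (normal_pdf 0 1)) => //.
- exact: measurable_normal_pdf.
- exact: normal_pdf_ge0.
Qed.

(** Completing the square turns [expR (k * x)] times the standard density into a constant times the
    normal density of mean [k]. All Gaussian integrability below rests on this. *)
Lemma gauss1_mgf (k : R) :
  \int[gauss1]_x (expR (k * x))%:E = (expR (k ^+ 2 / 2))%:E.
Proof.
rewrite ge0_integral_gauss1; last 2 first.
- by apply/measurable_EFinP; apply: measurableT_comp.
- by move=> x; rewrite lee_fin expR_ge0.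
have E (x : R) : (expR (k * x) * normal_pdf 0 1 x =
    expR (k ^+ 2 / 2) * normal_pdf k 1 x)%R.
  rewrite !normal_pdfE ?oner_eq0// /normal_fun mulrCA [RHS]mulrCA.
  by rewrite -!expRD; congr (_ * expR _)%R; by field.
under eq_integral do rewrite -EFinM E EFinM.
rewrite ge0_integralZl//.
- by rewrite integral_normal_pdf mule1.
- by apply/measurable_EFinP; exact: measurable_normal_pdf.
- by move=> x _; rewrite lee_fin normal_pdf_ge0.
Qed.

(** The density is a product over coordinates, so Tonelli separates the first one. This links the
    measure defined by a density on tuples to iterated one-dimensional integrals. *)
Lemma gauss_prob_cons n (A : set (n.+1.-tuple R)) : measurable A ->
  gauss_prob A = pushforward (gauss1 \x @gauss_prob R n) (@tcons _ R n) A.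
Proof.
move=> mA.
have mB : measurable (@tcons _ R n @^-1` A).
  by rewrite -[X in measurable X]setTI; exact: measurable_tcons.
rewrite {1}/gauss_prob /= /cons_measure.
rewrite ge0_integral_pushforward//; last 3 first.
- exact: measurable_tcons.
- by apply/measurable_funTS/measurable_EFinP; exact: measurable_gauss_pdf.
- by move=> x _; rewrite lee_fin gauss_pdf_ge0.
rewrite /pushforward; set B := _ @^-1` A.
rewrite integral_mkcond/= fubini_tonelli1//=; last 2 first.
- apply/measurable_restrict => //; apply: measurable_funTS.
  apply/measurable_EFinP.
  apply: (measurableT_comp (@measurable_gauss_pdf R n.+1)).
  exact: measurable_tcons.
- by move=> x; apply: erestrict_ge0 => y _; rewrite lee_fin gauss_pdf_ge0.
rewrite /product_measure1/=.
rewrite ge0_integral_gauss1//; last exact: measurable_fun_xsection.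
apply: eq_integral => s _; rewrite /fubini_F/=.
rewrite /gauss_prob muleC -ge0_integralZl//.
- rewrite [RHS]integral_mkcond; apply: eq_integral => t _.
  rewrite !patchE mem_xsection.
  by case: ifPn => //= _; rewrite gauss_pdf_cons EFinM.
- exact: measurable_xsection.
- by apply/measurable_funTS/measurable_EFinP; exact: measurable_gauss_pdf.
- by move=> x _; rewrite lee_fin gauss_pdf_ge0.
- by rewrite lee_fin normal_pdf_ge0.
Qed.

End Gauss.

(** * Partial integrals *)

Section Tame.
Context (R : realType) (n : nat).
Implicit Types (x y : nat -> R) (G : (nat -> R) -> R).

(* Points of R^n are sequences of which only the entries below n matter, so that
   partial integrals over any set of coordinates live on one type. *)
Definition upd x (j : nat) (s : R) : nat -> R :=
  fun i => if i == j then s else x i.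

Definition l1norm x : R := \sum_(j < n) `|x j|.

Definition l1dist x y : R := \sum_(j < n) `|x j - y j|.

(* Regularity class preserved by integrating out a Gaussian coordinate: both
   bounds simply integrate. *)
Definition tame G := exists C k : R, [/\ 0 <= C, 0 <= k,
  forall x, `|G x| <= C * expR (k * l1norm x) &
  forall x y,
    `|G x - G y| <= C * l1dist x y * expR (k * (l1norm x + l1norm y))].

Lemma l1norm_ge0 x : 0 <= l1norm x. Proof. exact: sumr_ge0. Qed.

Lemma l1dist_ge0 x y : 0 <= l1dist x y. Proof. exact: sumr_ge0. Qed.

Lemma updd x j s : upd x j s j = s. Proof. by rewrite /upd eqxx. Qed.

Lemma upd_neq x j s i : i != j -> upd x j s i = x i.
Proof. by rewrite /upd => /negbTE ->. Qed.

Lemma upd_upd x j s t : upd (upd x j s) j t = upd x j t.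
Proof. by apply/funext => i; rewrite /upd; case: eqP. Qed.

Lemma updC x i j s t : i != j -> upd (upd x i s) j t = upd (upd x j t) i s.
Proof.
move=> ij; apply/funext => k; rewrite /upd.
by have [->|//] := eqVneq k j; rewrite eq_sym (negbTE ij).
Qed.

Lemma l1norm_upd x j s : l1norm (upd x j s) <= l1norm x + `|s|.
Proof.
rewrite /l1norm; have [jn|nj] := ltnP j n; last first.
  rewrite (eq_bigr (fun i : 'I_n => `|x i|)) ?lerDl// => i _.
  by rewrite upd_neq// neq_ltn (leq_trans (ltn_ord i) nj).
rewrite (bigD1 (Ordinal jn))//= updd addrC lerD2r.
rewrite [leRHS](bigD1 (Ordinal jn))//= -[leLHS]add0r lerD//.
by apply: ler_sum => i ij; rewrite upd_neq.
Qed.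

Lemma l1dist_upd2 x y j s : l1dist (upd x j s) (upd y j s) <= l1dist x y.
Proof.
apply: ler_sum => i _; rewrite /upd; case: ifP => // _.
by rewrite subrr normr0.
Qed.

Lemma l1dist_upd x j s t : l1dist (upd x j s) (upd x j t) <= `|s - t|.
Proof.
rewrite /l1dist; have [jn|nj] := ltnP j n; last first.
  rewrite big1// => i _.
  by rewrite !upd_neq ?subrr ?normr0// neq_ltn (leq_trans (ltn_ord i) nj).
rewrite (bigD1 (Ordinal jn))//= !updd big1 ?addr0// => i ij.
by rewrite !upd_neq ?subrr ?normr0.
Qed.

Lemma l1norm_le x y : l1norm x <= l1norm y + l1dist x y.
Proof.
rewrite -big_split; apply: ler_sum => i _ /=.
by rewrite addrC -lerBlDr lerB_dist.
Qed.

Lemma ler_expRM (C C' k k' a : R) : 0 <= C -> C <= C' -> k <= k' -> 0 <= a ->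
  C * expR (k * a) <= C' * expR (k' * a).
Proof.
move=> C0 CC kk a0; apply: ler_pM => //.
by rewrite ler_expR ler_wpM2r.
Qed.

Lemma tame_weaken G (C C' k k' : R) : 0 <= C -> C <= C' -> k <= k' ->
  (forall x, `|G x| <= C * expR (k * l1norm x)) ->
  (forall x y,
     `|G x - G y| <= C * l1dist x y * expR (k * (l1norm x + l1norm y))) ->
  (forall x, `|G x| <= C' * expR (k' * l1norm x)) /\
  (forall x y,
     `|G x - G y| <= C' * l1dist x y * expR (k' * (l1norm x + l1norm y))).
Proof.
move=> C0 CC kk b l; split=> [x|x y].
  by apply: (le_trans (b x)); apply: ler_expRM => //; exact: l1norm_ge0.
apply: (le_trans (l x y)); apply: ler_expRM => //.
- by rewrite mulr_ge0 ?l1dist_ge0.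
- by rewrite ler_wpM2r ?l1dist_ge0.
- by rewrite addr_ge0 ?l1norm_ge0.
Qed.

Lemma tame_common G1 G2 : tame G1 -> tame G2 -> exists C k : R,
  [/\ 0 <= C, 0 <= k,
    (forall x, `|G1 x| <= C * expR (k * l1norm x)) /\
    (forall x y, `|G1 x - G1 y| <=
      C * l1dist x y * expR (k * (l1norm x + l1norm y))) &
    (forall x, `|G2 x| <= C * expR (k * l1norm x)) /\
    (forall x y, `|G2 x - G2 y| <=
      C * l1dist x y * expR (k * (l1norm x + l1norm y)))].
Proof.
move=> [C1 [k1 [C10 k10 b1 l1]]] [C2 [k2 [C20 k20 b2 l2]]].
exists (C1 + C2), (k1 + k2); split; rewrite ?addr_ge0//.
- by apply: (tame_weaken _ _ _ b1 l1); rewrite ?lerDl.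
- by apply: (tame_weaken _ _ _ b2 l2); rewrite ?lerDr.
Qed.

Lemma tame_dominated G G1 G2 : tame G1 -> tame G2 ->
  (forall x, `|G x| <= `|G1 x| + `|G2 x|) ->
  (forall x y, `|G x - G y| <= `|G1 x - G1 y| + `|G2 x - G2 y|) -> tame G.
Proof.
move=> t1 t2 b l.
have [C [k [C0 k0 [b1 l1] [b2 l2]]]] := tame_common t1 t2.
exists (C + C), k; split => //; first exact: addr_ge0.
- by move=> x; rewrite mulrDl (le_trans (b x))// lerD.
- by move=> x y; rewrite !mulrDl (le_trans (l x y))// lerD.
Qed.

Lemma tame_cst (a : R) : tame (fun=> a).
Proof.
exists `|a|, 0; split => // [x|x y].
  by rewrite mul0r expR0 mulr1.
by rewrite subrr normr0 mul0r expR0 mulr1 mulr_ge0 ?l1dist_ge0.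
Qed.

Lemma tameD G1 G2 : tame G1 -> tame G2 -> tame (fun x => G1 x + G2 x).
Proof.
move=> t1 t2; apply: (tame_dominated t1 t2) => [x|x y]; first exact: ler_normD.
by rewrite opprD addrACA ler_normD.
Qed.

Lemma tameM G1 G2 : tame G1 -> tame G2 -> tame (fun x => G1 x * G2 x).
Proof.
move=> t1 t2; have [C [k [C0 k0 [b1 l1] [b2 l2]]]] := tame_common t1 t2.
exists (C * C + C * C), (k + k); split => //.
- by rewrite addr_ge0// mulr_ge0.
- exact: addr_ge0.
- move=> x; rewrite normrM.
  apply: (@le_trans _ _ (C * C * expR ((k + k) * l1norm x))); last first.
    by rewrite ler_wpM2r ?expR_ge0// lerDl mulr_ge0.
  by rewrite mulrDl expRD mulrACA ler_pM.
move=> x y.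
have -> : G1 x * G2 x - G1 y * G2 y =
    G1 x * (G2 x - G2 y) + (G1 x - G1 y) * G2 y by ring.
have e1 : expR (k * l1norm x) <= expR (k * (l1norm x + l1norm y)).
  by rewrite ler_expR ler_wpM2l// lerDl l1norm_ge0.
have e2 : expR (k * l1norm y) <= expR (k * (l1norm x + l1norm y)).
  by rewrite ler_expR ler_wpM2l// lerDr l1norm_ge0.
have {}b1 := le_trans (b1 x) (ler_wpM2l C0 e1).
have {}b2 := le_trans (b2 y) (ler_wpM2l C0 e2).
rewrite (le_trans (ler_normD _ _))// !normrM.
set e := expR (k * (l1norm x + l1norm y)) in e1 e2 b1 b2 *.
have -> : (C * C + C * C) * l1dist x y *
    expR ((k + k) * (l1norm x + l1norm y)) =
  (C * e) * (C * l1dist x y * e) + (C * l1dist x y * e) * (C * e).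
  by rewrite [(k + k) * _]mulrDl expRD -/e; ring.
by apply: lerD; apply: ler_pM.
Qed.

Lemma tameZ (a : R) G : tame G -> tame (fun x => a * G x).
Proof. by move=> t; apply: (tameM (tame_cst a) t). Qed.

Lemma tameN G : tame G -> tame (fun x => - G x).
Proof.
by move=> tG; have := tameZ (-1) tG; under eq_fun do rewrite mulN1r.
Qed.

Lemma tameB G1 G2 : tame G1 -> tame G2 -> tame (fun x => G1 x - G2 x).
Proof. by move=> t1 t2; exact: (tameD t1 (tameN t2)). Qed.

Lemma tame_norm G : tame G -> tame (fun x => `|G x|).
Proof.
move=> [C [k [C0 k0 b l]]]; exists C, k; split => // [x|x y].
  by rewrite normr_id.
exact: le_trans (ler_dist_dist _ _) (l x y).
Qed.

Definition l1lip (L : R) G := forall x y, `|G x - G y| <= L * l1dist x y.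

Lemma l1lip_bound L G : 0 <= L -> l1lip L G ->
  forall x, `|G x| <= `|G (fun=> 0)| + L * l1norm x.
Proof.
move=> L0 lG x; rewrite -[G x in leLHS](subrK (G (fun=> 0))) addrC.
rewrite (le_trans (ler_normD _ _))// lerD2l (le_trans (lG _ _))//.
rewrite ler_wpM2l// /l1dist /l1norm.
by under eq_bigr do rewrite subr0.
Qed.

Lemma tame_l1lip L G : 0 <= L -> l1lip L G -> tame G.
Proof.
move=> L0 lG; exists (`|G (fun=> 0)| + L), 1; split => // [|x|x y].
- by rewrite addr_ge0.
- have := l1lip_bound L0 lG x; have := l1norm_ge0 x; rewrite mul1r.
  have := expR_ge1Dx (l1norm x); have := normr_ge0 (G (fun=> 0)); nra.
- apply: (le_trans (lG x y)).
  rewrite -[leLHS]mulr1 ler_pM// ?mulr_ge0 ?l1dist_ge0//.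
    by rewrite ler_wpM2r ?l1dist_ge0// lerDr.
  by rewrite mul1r -[leLHS]expR0 ler_expR addr_ge0 ?l1norm_ge0.
Qed.

Lemma l1lip_coord (j : nat) : (j < n)%N -> l1lip 1 (fun x => x j).
Proof.
move=> jn x y; rewrite mul1r /l1dist (bigD1 (Ordinal jn))//=.
by rewrite lerDl sumr_ge0.
Qed.

(** For [b <= a], factor out [expR a] and apply [1 + t <= expR t] at [t = b - a]. The exponent is
    symmetric so as to fit the increment bound in [tame]. *)
Lemma ler_dist_expR (a b : R) :
  `|expR a - expR b| <= `|a - b| * expR (`|a| + `|b|).
Proof.
wlog ab : a b / b <= a.
  move=> H; have [|/ltW] := leP b a; first exact: H.
  by move/H; rewrite distrC [`|a - b|]distrC [`|b| + _]addrC.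
rewrite [`|a - b|]ger0_norm ?subr_ge0// ger0_norm ?subr_ge0 ?ler_expR//.
have -> : expR a - expR b = expR a * (1 - expR (b - a)).
  by rewrite mulrBr mulr1 -expRD; congr (_ - expR _); ring.
rewrite mulrC; apply: ler_pM => //; rewrite ?expR_ge0//.
- by rewrite subr_ge0 -expR0 ler_expR subr_le0.
- by have := expR_ge1Dx (b - a); lra.
- by rewrite ler_expR (le_trans (ler_norm _))// lerDl.
Qed.

Lemma tame_expR L G : 0 <= L -> l1lip L G -> tame (fun x => expR (G x)).
Proof.
move=> L0 lG; set a := `|G (fun=> 0)|.
have a0 : 0 <= a by exact: normr_ge0.
(* Both points contribute the value [a] at the origin to the exponent [|G x| + |G y|], hence
   [expR (a + a)]; the first summand serves the growth bound, the second the increment bound. *)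
exists (expR (a + a) + L * expR (a + a)), L; split => //.
- by rewrite addr_ge0 ?mulr_ge0 ?expR_ge0.
- move=> x; have n0 := l1norm_ge0 x.
  rewrite ger0_norm ?expR_ge0//.
  apply: (@le_trans _ _ (expR (a + L * l1norm x))).
    by rewrite ler_expR (le_trans (ler_norm _))// l1lip_bound.
  rewrite expRD ler_wpM2r ?expR_ge0//.
  rewrite -[leLHS]addr0 lerD ?mulr_ge0 ?expR_ge0//.
  by rewrite ler_expR lerDl.
move=> x y; rewrite (le_trans (ler_dist_expR _ _))//.
apply: (@le_trans _ _
   (L * l1dist x y * expR ((a + L * l1norm x) + (a + L * l1norm y)))).
  by apply: ler_pM; rewrite ?expR_ge0// ler_expR lerD// l1lip_bound.
rewrite addrACA -mulrDr expRD mulrA ler_wpM2r ?expR_ge0//.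
rewrite mulrAC ler_wpM2r ?l1dist_ge0//.
by rewrite lerDr expR_ge0.
Qed.

End Tame.

(** * Measurability of tame functions *)

Section TameMeasurable.
Context (R : realType) (n : nat).
Implicit Types (x y : nat -> R) (G : (nat -> R) -> R).

Local Open Scope classical_set_scope.
Local Open Scope ring_scope.

(** A countable family of points; the default of [nth] puts zeros beyond [n], where [l1dist n] does
    not look. *)
Let qenv (q : n.-tuple rat) : nat -> R := fun i => ratr (nth 0 q i).

Let qenv_dense y (e : R) : 0 < e -> exists q, l1dist n y (qenv q) <= n%:R * e.
Proof.
move=> e0.
have H (i : 'I_n) : {q : rat | `|y i - ratr q| <= e}.
  have : y i - e < y i + e by lra.
  move=> /rat_in_itvoo/cid[q]; rewrite in_itv/= => /andP[q1 q2].
  by exists q; rewrite ler_norml; apply/andP; split; lra.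
exists (mktuple (fun i => sval (H i))).
apply: (@le_trans _ _ (\sum_(i < n) e)); last first.
  by rewrite sumr_const card_ord mulr_natl.
apply: ler_sum => i _; rewrite /qenv -tnth_nth tnth_mktuple.
exact: (svalP (H i)).
Qed.

(* A function with a local l1-modulus is a countable supremum of translates of
   its modulus. *)
Lemma measurable_tame d (T : measurableType d) (h : T -> nat -> R) G :
  tame n G -> (forall j, (j < n)%N -> measurable_fun setT (fun t => h t j)) ->
  measurable_fun setT (fun t => G (h t)).
Proof.
move=> [C [k [C0 k0 b l]]] mh.
(* The modulus of continuity makes [low q] a lower bound of [G] for every rational point [q]; [lowP]
   says that their supremum is [G]. *)
pose low q y := G (qenv q) - C * l1dist n y (qenv q) *
   expR (k * (l1norm n y + l1norm n (qenv q))).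
have lowP y a : (a < G y) <-> exists q, a < low q y.
  split=> [aG|[q]]; last first.
    move=> /lt_le_trans; apply; rewrite /low lerBlDr -lerBlDl.
    by have := l y (qenv q); rewrite distrC; exact/le_trans/ler_norm.
  pose E := C * expR (k * (l1norm n y + (l1norm n y + n%:R))).
  have E0 : 0 <= E by rewrite mulr_ge0 ?expR_ge0.
  have En0 : 0 <= E * n%:R by rewrite mulr_ge0.
  (* With [e = (G y - a) / D] one has [e <= 1] and [2 E n e < G y - a]. The factor 2 pays once for
     passing from [G y] to [G] at the rational point and once for the penalty inside [low]. *)
  pose D := (G y - a) + 2 * (E * n%:R) + 1.
  have D0 : 0 < D by rewrite /D; lra.
  pose e := (G y - a) / D.
  have e0 : 0 < e by rewrite divr_gt0// subr_gt0.
  have e1 : e <= 1 by rewrite ler_pdivrMr// mul1r /D; lra.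
  have eE : 2 * (E * n%:R) * e < G y - a.
    rewrite /e mulrA ltr_pdivrMr// mulrC ltr_pM2l ?subr_gt0// /D; lra.
  have [q yq] := qenv_dense y e0; exists q.
  have yq1 : l1dist n y (qenv q) <= n%:R.
    by rewrite (le_trans yq)// ler_piMr.
  have qn : l1norm n (qenv q) <= l1norm n y + n%:R.
    rewrite (le_trans (l1norm_le _ _ y))// lerD2l.
    rewrite (le_trans _ yq1)//; apply: ler_sum => i _; by rewrite distrC.
  have bd : C * l1dist n y (qenv q) *
      expR (k * (l1norm n y + l1norm n (qenv q))) <= (E * n%:R) * e.
    rewrite mulrAC -[leRHS]mulrA; apply: ler_pM => //.
    - by rewrite mulr_ge0 ?expR_ge0.
    - exact: l1dist_ge0.
    - by rewrite ler_wpM2l// ler_expR ler_wpM2l// lerD2l.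
  have := l y (qenv q); rewrite ler_norml => /andP[_ ly].
  rewrite /low; lra.
move=> mT; apply: (measurability _ (RGenOInfty.measurableE R)) => //.
move=> /= _ [_ [a ->] <-]; rewrite preimage_itvoy setTI.
rewrite [X in measurable X](_ : _ = \bigcup_(q : n.-tuple rat)
  ((fun t => low q (h t)) @^-1` `]a, +oo[)).
  apply: countable_bigcupT_measurable => [|q]; first exact: countableP.
  rewrite -[X in measurable X]setTI.
  suff: measurable_fun setT (fun t => low q (h t)).
    by apply => //; exact: measurable_itv.
  apply: measurable_funB => //; apply: measurable_funM.
    apply: measurable_funM => //; apply: measurable_sum => i.
    apply: measurableT_comp => //; apply: measurable_funB => //.
    exact: mh.
  apply: measurableT_comp => //; apply: measurable_funM => //.
  apply: measurable_funD => //; apply: measurable_sum => i.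
  apply: measurableT_comp => //; exact: mh.
apply/seteqP; split=> [t /= /lowP[q aq]|t [q _]].
  by exists q => //=; rewrite in_itv/= aq.
by rewrite /= in_itv/= andbT => aq; apply/lowP; exists q.
Qed.

End TameMeasurable.

(** * Integrating one Gaussian coordinate *)

Section TameIntegral.
Context (R : realType) (n : nat).
Implicit Types (x y : nat -> R) (G : (nat -> R) -> R).

Local Open Scope classical_set_scope.
Local Open Scope ring_scope.

(** Dominated by [expR (k * s) + expR (- k * s)], one of whose terms equals the integrand. *)
Lemma integrable_expR_abs (k : R) :
  (@gauss1 R).-integrable setT (EFin \o (fun s => expR (k * `|s|))).
Proof.
have I a : (@gauss1 R).-integrable setT (EFin \o (fun s => expR (a * s))).
  apply/integrableP; split.
    by apply/measurable_EFinP; apply: measurableT_comp.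
  under eq_integral do rewrite /= ger0_norm ?expR_ge0//.
  by rewrite gauss1_mgf ltry.
apply: (le_integrable _ _ _ (integrableD _ (I k) (I (- k)))) => //.
  apply/measurable_EFinP; apply: measurableT_comp => //.
  by apply: measurable_funM => //.
move=> s _ /=; rewrite lee_fin ger0_norm ?expR_ge0//.
rewrite [leRHS]ger0_norm; last first.
  by rewrite addr_ge0 ?expR_ge0.
have [s0|s0] := leP 0 s.
  by rewrite ger0_norm// lerDl expR_ge0.
by rewrite ltr0_norm// mulrN mulNr lerDr expR_ge0.
Qed.

Definition rI (j : nat) G x : R := \int[@gauss1 R]_s G (upd x j s).

Lemma measurable_upd x j i : measurable_fun setT (fun s : R => upd x j s i).
Proof. by rewrite /upd; case: (i == j). Qed.

Lemma integrable_tame j x G : tame n G ->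
  (@gauss1 R).-integrable setT (EFin \o (fun s => G (upd x j s))).
Proof.
move=> tG; have [C [k [C0 k0 b l]]] := tG.
apply: (le_integrable _ _ _
  (integrableZl _ (C * expR (k * l1norm n x)) (integrable_expR_abs k))) => //.
  apply/measurable_EFinP; apply: (measurable_tame tG) => i _.
  exact: measurable_upd.
move=> s _ /=; rewrite lee_fin [leRHS]ger0_norm ?mulr_ge0 ?expR_ge0//.
rewrite (le_trans (b _))// -mulrA ler_wpM2l// -expRD -mulrDr.
by rewrite ler_expR ler_wpM2l// l1norm_upd.
Qed.

Lemma rI_cst j (a : R) x : rI j (fun=> a) x = a.
Proof.
rewrite /rI Rintegral_cst//.
by rewrite (_ : _ setT = 1%E) ?mulr1//;
  exact: (@probability_setT _ _ _ (@gauss1 R)).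
Qed.

Lemma rID j G1 G2 x : tame n G1 -> tame n G2 ->
  rI j (fun y => G1 y + G2 y) x = rI j G1 x + rI j G2 x.
Proof. by move=> t1 t2; apply: RintegralD => //; exact: integrable_tame. Qed.

Lemma rIB j G1 G2 x : tame n G1 -> tame n G2 ->
  rI j (fun y => G1 y - G2 y) x = rI j G1 x - rI j G2 x.
Proof. by move=> t1 t2; apply: RintegralB => //; exact: integrable_tame. Qed.

Lemma rIZ j a G x : tame n G -> rI j (fun y => a * G y) x = a * rI j G x.
Proof. by move=> t1; apply: RintegralZl => //; exact: integrable_tame. Qed.

Lemma ler_rI j G1 G2 x : tame n G1 -> tame n G2 ->
  (forall s, G1 (upd x j s) <= G2 (upd x j s)) -> rI j G1 x <= rI j G2 x.
Proof.
by move=> t1 t2 H; apply: le_Rintegral => //; exact: integrable_tame.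
Qed.

Lemma eq_rI j G1 G2 x : (forall s, G1 (upd x j s) = G2 (upd x j s)) ->
  rI j G1 x = rI j G2 x.
Proof. by move=> H; apply: eq_Rintegral => s _; exact: H. Qed.

Lemma ler_norm_rI j G x : tame n G -> `|rI j G x| <= rI j (fun y => `|G y|) x.
Proof.
by move=> t; apply: le_normr_Rintegral => //; exact: integrable_tame.
Qed.

(** Writing [s] into a coordinate raises each norm by at most [|s|], so the growth bound picks up
    the moment [M k] and the increment bound, with its two norms, [M (k + k)]. The rate [k] itself
    is kept. *)
Lemma tame_rI j G : tame n G -> tame n (rI j G).
Proof.
move=> tG; have [C [k [C0 k0 b l]]] := tG.
pose M a : R := \int[@gauss1 R]_s expR (a * `|s|).
have M0 a : 0 <= M a by apply: Rintegral_ge0 => s _; exact: expR_ge0.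
exists (C * M k + C * M (k + k)), k; split => //.
- by rewrite addr_ge0// mulr_ge0.
- move=> x; rewrite (le_trans (ler_norm_rI _ _ tG))//.
  apply: (@le_trans _ _ (C * M k * expR (k * l1norm n x))); last first.
    by rewrite ler_wpM2r ?expR_ge0// lerDl mulr_ge0.
  rewrite mulrAC -RintegralZl//; last exact: integrable_expR_abs.
  apply: le_Rintegral => //.
  + by apply: (@integrable_tame j x (fun y => `|G y|)); exact: tame_norm.
  + exact: (integrableZl measurableT (C * expR (k * l1norm n x))
      (integrable_expR_abs k)).
  + move=> s _; rewrite (le_trans (b _))// -mulrA ler_wpM2l// -expRD -mulrDr.
    by rewrite ler_expR ler_wpM2l// l1norm_upd.
move=> x y; rewrite /rI -RintegralB//; try exact: integrable_tame.
have I : (@gauss1 R).-integrable setT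
    (EFin \o (fun s => G (upd x j s) - G (upd y j s))).
  by apply: (integrableB _ (integrable_tame j x tG) (integrable_tame j y tG)).
rewrite (le_trans (le_normr_Rintegral _ I))//.
apply: (@le_trans _ _
  (C * M (k + k) * l1dist n x y *
   expR (k * (l1norm n x + l1norm n y)))); last first.
  by rewrite ler_wpM2r ?expR_ge0// ler_wpM2r ?l1dist_ge0// lerDr mulr_ge0.
have -> : C * M (k + k) * l1dist n x y * expR (k * (l1norm n x + l1norm n y)) =
    C * l1dist n x y * expR (k * (l1norm n x + l1norm n y)) * M (k + k) by ring.
rewrite -RintegralZl//; last exact: integrable_expR_abs.
apply: le_Rintegral => //.
- exact: (integrable_norm I).
- exact: (integrableZl measurableT
    (C * l1dist n x y * expR (k * (l1norm n x + l1norm n y)))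
    (integrable_expR_abs (k + k))).
move=> s _; rewrite (le_trans (l _ _))// -[leRHS]mulrA -expRD.
apply: ler_pM.
- by rewrite mulr_ge0 ?l1dist_ge0.
- exact: expR_ge0.
- by rewrite ler_wpM2l// l1dist_upd2.
- have -> : k * (l1norm n x + l1norm n y) + (k + k) * `|s| =
    k * ((l1norm n x + `|s|) + (l1norm n y + `|s|)) by ring.
  by rewrite ler_expR ler_wpM2l// lerD// l1norm_upd.
Qed.

(** Fubini for [i != j], where the two updates commute; the growth bound of [G] dominates the
    integrand by a product of a function of [s] and a function of [t]. *)
Lemma rI_swap i j G x : tame n G -> rI i (rI j G) x = rI j (rI i G) x.
Proof.
have [->//|ij] := eqVneq i j.
move=> tG; have [C [k [C0 k0 b l]]] := tG.
pose f (p : R * R) : \bar R := (G (upd (upd x i p.1) j p.2))%:E.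
have mf : measurable_fun setT f.
  apply/measurable_EFinP; apply: (measurable_tame tG) => l0 _.
  rewrite /upd; case: (l0 == j); first exact: measurable_snd.
  by case: (l0 == i); [exact: measurable_fst|exact: measurable_cst].
have If : (@gauss1 R \x @gauss1 R)%E.-integrable setT f.
  apply/integrable12ltyP => //.
  set M : R := \int[@gauss1 R]_s expR (k * `|s|).
  have iM := integrable_expR_abs k.
  have ME : (\int[@gauss1 R]_s (expR (k * `|s|))%:E)%E = M%:E.
    by rewrite /M /Rintegral fineK//; exact: (integrable_fin_num _ iM).
  pose D := C * expR (k * l1norm n x).
  have D0 : 0 <= D by rewrite mulr_ge0 ?expR_ge0.
  have mE : measurable_fun setT (fun s : R => (expR (k * `|s|))%:E).
    by case/integrableP : iM.
  apply: (@le_lt_trans _ _ (\int[@gauss1 R]_s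
     ((D * M)%:E * (expR (k * `|s|))%:E))%E); last first.
    rewrite ge0_integralZl//.
    - by rewrite ME -EFinM ltry.
    - rewrite lee_fin mulr_ge0//.
      by apply: Rintegral_ge0 => s _; exact: expR_ge0.
  apply: ge0_le_integral => //.
  - by move=> s _; exact: integral_ge0.
  - apply: (measurable_fun_fubini_tonelli_F (m2 := @gauss1 R) (abse \o f)).
      exact: measurableT_comp.
    by move=> p /=.
  - by apply: emeasurable_funM.
  move=> s _; rewrite EFinM -ME muleAC -EFinM -ge0_integralZl//; last first.
    by rewrite lee_fin mulr_ge0 ?expR_ge0.
  apply: ge0_le_integral => //.
  - apply: measurableT_comp => //; apply: measurableT_comp => //.
  - by apply: emeasurable_funM.
  move=> t _; rewrite /f/= lee_fin (le_trans (b _))// /D.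
  rewrite -!mulrA ler_wpM2l// -!expRD -!mulrDr ler_expR ler_wpM2l//.
  rewrite (le_trans (l1norm_upd _ _ _ _))// addrA lerD2r.
  exact: l1norm_upd.
have E h u v : tame n u ->
    (\int[@gauss1 R]_s (u (upd v h s))%:E)%E = (rI h u v)%:E.
  move=> tu; rewrite /rI /Rintegral fineK//.
  exact: (integrable_fin_num _ (integrable_tame h v tu)).
have := Fubini If; rewrite /f/=.
under eq_integral do rewrite E//.
under [RHS]eq_integral do under eq_integral do rewrite updC//.
under [RHS]eq_integral do rewrite E//.
by rewrite !E; [case|exact: tame_rI|exact: tame_rI].
Qed.

End TameIntegral.

(** * Iterated integrals and the Gaussian measure on tuples *)

Section IteratedIntegral.
Context (R : realType) (n : nat).
Implicit Types (x y : nat -> R) (G : (nat -> R) -> R).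

Local Open Scope classical_set_scope.
Local Open Scope ring_scope.

Definition rIs (l : seq nat) G := foldr (@rI R) G l.

Lemma tame_rIs l G : tame n G -> tame n (rIs l G).
Proof. by move=> tG; elim: l => //= j l; exact: tame_rI. Qed.

Lemma rIs_ge0 l G x : (forall y, 0 <= G y) -> 0 <= rIs l G x.
Proof.
move=> G0; elim: l x => //= j l IH x.
by apply: Rintegral_ge0 => s _; exact: IH.
Qed.

(** The tuple fills consecutive coordinates starting at [k]; peeling off its head then becomes an
    update at [k] followed by a splice at [k.+1]. *)
Definition splice x (k : nat) (t : seq R) : nat -> R :=
  fun i => if (k <= i < k + size t)%N then nth 0 t (i - k) else x i.

Lemma splice_cons x k s t : splice x k (s :: t) = splice (upd x k s) k.+1 t.
Proof.
apply/funext => i; rewrite /splice /upd /= addnS addSn.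
have [->|ik] := eqVneq i k; first by rewrite leqnn ltnn ltnS leq_addr subnn.
rewrite [(k <= i)%N]leq_eqVlt eq_sym (negbTE ik)/=.
by have [ki|//] := ltnP k i; rewrite -(subnSK ki).
Qed.

(** Induction on [m] with [k] and [x] free: [gauss_prob_cons] splits off the head of the tuple, and
    pushforward and Fubini make its integral the outermost [rI]. *)
Lemma integral_gauss_prob m k x G : tame n G ->
  (@gauss_prob R m).-integrable setT
    (fun t : m.-tuple R => (G (splice x k t))%:E) /\
  (\int[@gauss_prob R m]_t (G (splice x k t))%:E)%E = (rIs (iota k m) G x)%:E.
Proof.
elim: m k x G => [|m IH] k x G tG.
  have E (t : 0.-tuple R) : splice x k t = x.
    by apply/funext => i; rewrite /splice tuple0 /= addn0 ltnNge andbN.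
  under eq_integral do rewrite E.
  rewrite (_ : (fun _ => _) = cst (G x)%:E); last first.
    by apply/funext => t; rewrite E.
  split; first exact: finite_measure_integrable_cst.
  rewrite integral_cst//=.
  by rewrite (_ : _ setT = 1%E) ?mule1//;
    exact: (@probability_setT _ _ _ (@gauss_prob R 0)).
pose f (t : m.+1.-tuple R) := (G (splice x k t))%:E.
pose g (p : R * m.-tuple R) := (G (splice (upd x k p.1) k.+1 p.2))%:E.
have fg : f \o (@tcons _ R m) = g.
  by apply/funext => -[s t]; rewrite /f /g /= splice_cons.
have mf : measurable_fun setT f.
  apply/measurable_EFinP; apply: (measurable_tame tG) => i _.
  rewrite /splice; under eq_fun do rewrite size_tuple.
  have [/andP[ki im]|_] := boolP (k <= i < k + m.+1)%N;
    last exact: measurable_cst.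
  have im' : (i - k < m.+1)%N by rewrite ltn_subLR.
  rewrite (_ : (fun _ => _) = (fun t : m.+1.-tuple R => tnth t (Ordinal im'))).
    exact: measurable_tnth.
  by apply/funext => t; rewrite (tnth_nth 0).
have mg : measurable_fun setT g.
  by rewrite -fg; apply: measurableT_comp => //; exact: measurable_tcons.
(* The induction hypothesis for [|G|] evaluates the inner integral as a tame function of [x], whose
   integral in [s] is finite. *)
have Ig : (@gauss1 R \x @gauss_prob R m)%E.-integrable setT g.
  apply/integrable12ltyP => //.
  under eq_integral.
    move=> s _; rewrite /g/=.
    have [_ ->] := IH k.+1 (upd x k s) (fun y => `|G y|) (tame_norm tG).
    over.
  have tN := tame_rIs (iota k.+1 m) (tame_norm tG).
  have /integrableP[_] := integrable_tame k x tN.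
  apply: le_lt_trans; apply: ge0_le_integral => //.
  + by move=> s _; rewrite lee_fin; apply: rIs_ge0 => y.
  + by case/integrableP : (integrable_tame k x tN).
  + apply: measurableT_comp => //.
    by case/integrableP : (integrable_tame k x tN).
  + by move=> s _ /=; rewrite lee_fin ler_norm.
have mtc : measurable_fun [set: (measurableTypeR R * m.-tuple R)%type]
    (@tcons _ R m).
  apply: measurable_cons; [exact: measurable_fst|exact: measurable_snd].
have PE A : measurable A -> A `<=` setT -> gauss_prob A =
    pushforward (@gauss1 R \x @gauss_prob R m)%E (@tcons _ R m) A.
  by move=> mA _; exact: gauss_prob_cons.
have Ifg : (@gauss1 R \x @gauss_prob R m)%E.-integrable
    (@tcons _ R m @^-1` setT) (f \o @tcons _ R m).
  by rewrite fg preimage_setT.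
split.
  apply/integrableP; split => //.
  rewrite (eq_measure_integral _ PE)//.
  by have /integrableP[] := integrable_pushforward mtc mf Ifg measurableT.
rewrite (eq_measure_integral _ PE)//.
rewrite (integral_pushforward mtc mf Ifg)// preimage_setT.
transitivity (\int[@gauss1 R \x @gauss_prob R m]_z g z)%E.
  by apply: eq_integral => z _; rewrite -fg.
rewrite -integral12_prod_meas1//; rewrite /fubini_F/=.
under eq_integral.
  move=> s _; rewrite /g/=.
  have [_ ->] := IH k.+1 (upd x k s) G tG.
  over.
rewrite /rI /Rintegral fineK//.
exact: (integrable_fin_num _ (integrable_tame k x (tame_rIs (iota k.+1 m) tG))).
Qed.
End IteratedIntegral.

(** * Complex exponential *)

Section Normc.
Context (R : realType).
Implicit Types z w : R[i].
Local Notation Re := complex.Re.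
Local Notation Im := complex.Im.

Lemma normcE2 z : normc z ^+ 2 = Re z ^+ 2 + Im z ^+ 2.
Proof. by case: z => a b /=; rewrite sqr_sqrtr// addr_ge0 ?sqr_ge0. Qed.

Lemma normc_ge0 z : 0 <= normc z.
Proof. by case: z => a b; exact: sqrtr_ge0. Qed.

Lemma normc_gt0 z : z != 0 -> 0 < normc z.
Proof.
move=> z0; rewrite lt_neqAle normc_ge0 andbT eq_sym.
by apply: contra z0 => /eqP/eq0_normc ->.
Qed.

Lemma ler_norm_Re z : `|Re z| <= normc z.
Proof.
rewrite -(@ler_pXn2r _ 2) ?nnegrE ?normc_ge0// normcE2 real_normK ?num_real//.
by rewrite lerDl sqr_ge0.
Qed.

Lemma ler_norm_Im z : `|Im z| <= normc z.
Proof.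
rewrite -(@ler_pXn2r _ 2) ?nnegrE ?normc_ge0// normcE2 real_normK ?num_real//.
by rewrite lerDr sqr_ge0.
Qed.

Lemma ler_normc z : normc z <= `|Re z| + `|Im z|.
Proof.
rewrite -(@ler_pXn2r _ 2) ?nnegrE ?normc_ge0 ?addr_ge0// normcE2.
rewrite sqrrD !real_normK ?num_real// addrAC lerDl.
by rewrite mulrn_wge0// mulr_ge0.
Qed.

Lemma ler_normcD z w : normc (z + w) <= normc z + normc w.
Proof. exact: le_normcD. Qed.

Lemma normcB z w : normc (z - w) = normc (w - z).
Proof. by rewrite -normcN opprB. Qed.

Lemma ler_normc_sub z w : `|normc z - normc w| <= normc (z - w).
Proof.
rewrite ler_norml; apply/andP; split.
  by rewrite lerNl opprB lerBlDr normcB -[in leLHS](subrK z w) ler_normcD.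
by rewrite lerBlDr -[in leLHS](subrK w z) ler_normcD.
Qed.

Lemma ler_normc_sum (I : Type) (r : seq I) (P : pred I) (F : I -> R[i]) :
  normc (\sum_(i <- r | P i) F i) <= \sum_(i <- r | P i) normc (F i).
Proof.
elim/big_rec2 : _ => [|i y x _ H]; first by rewrite normc0.
by rewrite (le_trans (ler_normcD _ _))// lerD2l.
Qed.

Lemma ReD z w : Re (z + w) = Re z + Re w.
Proof. by case: z w => [a b] [c d]. Qed.

Lemma ImD z w : Im (z + w) = Im z + Im w.
Proof. by case: z w => [a b] [c d]. Qed.

Lemma ReB z w : Re (z - w) = Re z - Re w.
Proof. by case: z w => [a b] [c d]. Qed.

Lemma ImB z w : Im (z - w) = Im z - Im w.
Proof. by case: z w => [a b] [c d]. Qed.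

Lemma ReM z w : Re (z * w) = Re z * Re w - Im z * Im w.
Proof. by case: z w => [a b] [c d]. Qed.

Lemma ImM z w : Im (z * w) = Re z * Im w + Im z * Re w.
Proof. by case: z w => [a b] [c d]. Qed.

Lemma complex_eq z w : Re z = Re w -> Im z = Im w -> z = w.
Proof. by case: z w => [a b] [c d] /= -> ->. Qed.

End Normc.

Section Cexp.
Import numFieldNormedType.Exports.
Context (R : realType).
Implicit Types z w : R[i].
Local Notation Re := complex.Re.
Local Notation Im := complex.Im.

Lemma normc_cexp z : normc (cexp z) = expR (Re z).
Proof.
rewrite /cexp /= !exprMn -mulrDr cos2Dsin2 mulr1 sqrtr_sqr ger0_norm//.
Qed.

Lemma cexpD z w : cexp (z + w) = cexp z * cexp w.
Proof.
apply: complex_eq; rewrite ?ReM ?ImM /cexp /= ReD ImD expRD ?cosD ?sinD; ring.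
Qed.

Lemma cexp_neq0 z : cexp z != 0.
Proof.
apply/eqP => z0; have := normc_cexp z; rewrite z0 normc0 => /esym/eqP.
by rewrite gt_eqF// expR_gt0.
Qed.

(** Bounding the distance of [c] to both ends, instead of placing it between them, keeps the claim
    symmetric in [a] and [b], as the reduction to [b <= a] requires. *)
Lemma sin_mean_value (a b : R) : exists c,
  [/\ `|c - a| <= `|a - b|, `|c - b| <= `|a - b| &
      sin a - sin b = cos c * (a - b)].
Proof.
wlog ab : a b / b <= a.
  move=> H; have [|/ltW ab] := leP b a; first exact: H.
  have [c [ca cb E]] := H _ _ ab; exists c.
  by rewrite (distrC a b); split=> //; rewrite -opprB E; ring.
have [|c cab E] := @MVT_segment R (@sin R) (@cos R) b a ab
    (fun x _ => is_derive_sin x).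
  by apply: continuous_subspaceT; exact: continuous_sin.
exists c; move: cab; rewrite in_itv/= => /andP[bc ca].
rewrite [`|c - a|]distrC !ger0_norm ?subr_ge0//.
by split=> //; [rewrite lerD2l lerN2|rewrite lerD2r].
Qed.

Lemma ler_dist_sin (a b : R) : `|sin a - sin b| <= `|a - b|.
Proof.
have [c [_ _ ->]] := sin_mean_value a b.
by rewrite normrM ler_piMl// ler_norml cos_le1 andbT cos_geN1.
Qed.

Lemma ler_dist_cos (a b : R) : `|cos a - cos b| <= `|a - b|.
Proof.
have cosE x : cos x = sin (x + pi / 2) :> R by rewrite sinDpihalf.
by rewrite !cosE (le_trans (ler_dist_sin _ _))// opprD addrACA subrr addr0.
Qed.

(** From [cos v = 1 - 2 sin^2 (v / 2)] and [|sin t| <= |t|]. *)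
Lemma cos_ge1B (v : R) : 1 - v ^+ 2 / 2 <= cos v.
Proof.
have h := ler_dist_sin (v / 2) 0; rewrite sin0 !subr0 in h.
have {h} : sin (v / 2) ^+ 2 <= (v / 2) ^+ 2.
  rewrite -[leLHS]real_normK ?num_real// -[leRHS]real_normK ?num_real//.
  by rewrite lerXn2r ?nnegrE.
rewrite [v in cos v](_ : v = v / 2 + v / 2); last by lra.
by rewrite cosD; have := cos2Dsin2 (v / 2); lra.
Qed.

Lemma ler_dist_sin_id (v : R) : `|sin v - v| <= v ^+ 2.
Proof.
have [c [_ c0]] := sin_mean_value v 0; rewrite sin0 !subr0 in c0 * => ->.
rewrite -[X in _ - X]mul1r -mulrBl normrM -[leRHS]real_normK ?num_real// expr2.
apply: ler_wpM2r => //; rewrite -cos0 (le_trans (ler_dist_cos _ _))//.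
by rewrite subr0.
Qed.

Lemma ler_expR1 (u : R) : `|expR u - 1| <= `|u| * expR `|u|.
Proof. by have := ler_dist_expR u 0; rewrite expR0 subr0 normr0 addr0. Qed.

(** Since [expR u - 1 <= u * expR u], the remainder is at most [u * (expR u - 1)], and [ler_expR1]
    bounds the second factor. *)
Lemma ler_expR2 (u : R) : `|expR u - 1 - u| <= u ^+ 2 * expR `|u|.
Proof.
have l := expR_ge1Dx u; rewrite ger0_norm; last by lra.
have h : expR u - 1 <= u * expR u.
  have := expR_ge1Dx (- u); have := expRxMexpNx_1 u.
  have := expR_gt0 u; have := expR_gt0 (- u); nra.
apply: (@le_trans _ _ (u * (expR u - 1))); first by lra.
rewrite (le_trans (ler_norm _))// normrM.
rewrite -[X in X * expR _]real_normK ?num_real//.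
by rewrite expr2 -mulrA ler_wpM2l// ler_expR1.
Qed.

(** Real and imaginary remainders are split into four pieces which, after [2 |u v| <= u^2 + v^2],
    add up to at most [(3/2 u^2 + 2 v^2) E]; this explains the constant 2. *)
Lemma cexp_approx w :
  normc (cexp w - 1 - w) <= 2 * normc w ^+ 2 * expR (normc w).
Proof.
case: w => u v; set N := normc (Complex u v).
have N2 : N ^+ 2 = u ^+ 2 + v ^+ 2 by rewrite /N normcE2.
have uN : `|u| <= N by exact: (ler_norm_Re (Complex u v)).
have N0 : 0 <= N by exact: normc_ge0.
set E := expR N.
have E1 : 1 <= E by rewrite -expR0 ler_expR.
have uE : expR `|u| <= E by rewrite ler_expR.
rewrite (le_trans (ler_normc _))//=.
have -> : expR u * cos v - 1 - u =
  (expR u - 1 - u) + expR u * (cos v - 1) by ring.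
have -> : expR u * sin v - 0 - v = (expR u - 1) * sin v + (sin v - v) by ring.
have e1 : `|expR u - 1 - u| <= u ^+ 2 * E.
  by rewrite (le_trans (ler_expR2 _))// ler_wpM2l// sqr_ge0.
have e2 : `|expR u * (cos v - 1)| <= E * (v ^+ 2 / 2).
  rewrite normrM ger0_norm ?expR_ge0// ler_pM ?expR_ge0//.
    by rewrite (le_trans _ uE)// ler_expR ler_norm.
  rewrite ler_norml; apply/andP; split; have := cos_ge1B v; have := cos_le1 v;
    have := sqr_ge0 v; lra.
have e3 : `|(expR u - 1) * sin v| <= (`|u| * E) * `|v|.
  rewrite normrM ler_pM//.
    by rewrite (le_trans (ler_expR1 _))// ler_wpM2l.
  by have := ler_dist_sin v 0; rewrite sin0 !subr0.
have e4 := ler_dist_sin_id v.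
have d1 := ler_normD (expR u - 1 - u) (expR u * (cos v - 1)).
have d2 := ler_normD ((expR u - 1) * sin v) (sin v - v).
have uv : 2 * (`|u| * `|v|) <= u ^+ 2 + v ^+ 2.
  rewrite -[u ^+ 2]real_normK ?num_real// -[v ^+ 2]real_normK ?num_real//.
  have := sqr_ge0 (`|u| - `|v|); nra.
have v2 : v ^+ 2 <= v ^+ 2 * E by rewrite ler_peMr ?sqr_ge0.
have uvE : 2 * (`|u| * E * `|v|) <= (u ^+ 2 + v ^+ 2) * E.
  have -> : 2 * (`|u| * E * `|v|) = (2 * (`|u| * `|v|)) * E by ring.
  by rewrite ler_wpM2r// (le_trans _ E1).
have u2 : 0 <= u ^+ 2 * E by rewrite mulr_ge0 ?sqr_ge0 ?expR_ge0.
rewrite N2; lra.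
Qed.

End Cexp.

(** * Non-vanishing functions with small relative increments *)

Section Chain.
Context (R : realType).
Local Notation Re := complex.Re.
Local Notation Im := complex.Im.

(** Cut the segment into equal steps no longer than [eta] and add the local bounds by the triangle
    inequality. [D] will be an increment of [ln |z|] or a distance between phases. *)
Lemma chain_bound (D : R -> R -> R) (kappa eta : R) : 0 < eta ->
  (forall a b c, D a c <= D a b + D b c) ->
  (forall a b, `|b - a| <= eta -> D a b <= kappa * `|b - a|) ->
  forall a b, D a b <= kappa * `|b - a|.
Proof.
move=> eta0 tri loc a b.
have [N hN] : exists N : nat, `|b - a| <= N.+1%:R * eta.
  exists (Num.bound (`|b - a| / eta)).
  rewrite -ler_pdivrMr//; apply/ltW.
  have h : 0 <= `|b - a| / eta by rewrite divr_ge0// ltW.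
  by rewrite (lt_trans (archi_boundP h))// ltr_nat.
pose p (k : nat) := a + (b - a) * (k%:R / N.+1%:R).
have pE k : `|p k.+1 - p k| = `|b - a| / N.+1%:R.
  rewrite /p (_ : _ - _ = (b - a) / N.+1%:R).
    by rewrite normrM [X in _ * X]ger0_norm.
  rewrite -[k.+1%:R]natr1.
  have : N.+1%:R != 0 :> R by rewrite pnatr_eq0.
  by move: N.+1%:R => M M0; field.
have pN : `|b - a| / N.+1%:R <= eta by rewrite ler_pdivrMr// mulrC.
have H k : D a (p k) <= kappa * (`|b - a| * (k%:R / N.+1%:R)).
  elim: k => [|k IH].
    rewrite /p !mul0r !mulr0 addr0.
    by have := loc a a; rewrite subrr normr0 mulr0; apply; exact: ltW.
  rewrite (le_trans (tri _ (p k) _))//.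
  have := loc (p k) (p k.+1); rewrite pE => /(_ pN) h.
  rewrite (le_trans (lerD IH h))// -[k.+1%:R]natr1.
  by rewrite [(_ + 1) / _]mulrDl mul1r !mulrDr.
by have := H N.+1; rewrite /p divff ?pnatr_eq0// !mulr1 addrC subrK.
Qed.

Variables (z : R -> R[i]) (kappa C0 : R).
Hypotheses (kappa0 : 0 <= kappa) (C00 : 0 <= C0) (z0 : forall s, z s != 0).
Hypothesis z_loc : forall s t, `|t - s| <= 1 ->
  normc (z t - z s) <= normc (z s) * (kappa * `|t - s| + C0 * `|t - s| ^+ 2).

Let chain_limit (D : R -> R -> R) :
  (forall a b c, D a c <= D a b + D b c) ->
  (forall a b, `|b - a| <= 1 ->
     D a b <= kappa * `|b - a| + C0 * `|b - a| ^+ 2) ->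
  forall a b, D a b <= kappa * `|b - a|.
Proof.
move=> tri loc a b; apply/ler_addgt0Pr => e e0.
pose dl := e / (`|b - a| + 1).
have ba : 0 < `|b - a| + 1 by rewrite ltr_wpDl.
have dl0 : 0 < dl by rewrite divr_gt0.
(* On steps this short the quadratic term costs at most [dl] per unit length, hence at most [e] in
   total. The minimum with 1 keeps the local bound applicable; [C0 + 1] avoids dividing by zero. *)
pose eta := Num.min 1 (dl / (C0 + 1)).
have C01 : 0 < C0 + 1 by rewrite ltr_wpDl.
have eta0 : 0 < eta by rewrite lt_min ltr01 divr_gt0.
apply: (@le_trans _ _ ((kappa + dl) * `|b - a|)).
  apply: (chain_bound eta0 tri) => s t; rewrite /eta le_min => /andP[st1].
  rewrite ler_pdivlMr// => st2.
  rewrite (le_trans (loc _ _ st1))// mulrDl lerD2l expr2 mulrA ler_wpM2r//.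
  by rewrite (le_trans _ st2)// mulrDr mulr1 mulrC lerDl.
rewrite mulrDl lerD2l /dl mulrAC ler_pdivrMr// ler_wpM2l ?(ltW e0)//.
by rewrite lerDl.
Qed.

(** [ln |z|] has increments at most [ln (1 + e) <= e] with [e] the local relative bound, so
    [chain_limit] applies to it. *)
Lemma chain_norm a b : normc (z b) <= normc (z a) * expR (kappa * `|b - a|).
Proof.
have nz s : 0 < normc (z s) by exact: normc_gt0.
rewrite -ler_ln ?posrE ?mulr_gt0 ?expR_gt0// lnM ?posrE ?expR_gt0// expRK.
rewrite -lerBlDl.
apply: (chain_limit (D := fun a b => ln (normc (z b)) - ln (normc (z a)))).
  by move=> u v w; lra.
move=> u v uv; set e := (X in _ <= X).
rewrite lerBlDl -[e]expRK -lnM ?posrE ?expR_gt0//.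
rewrite ler_ln ?posrE ?mulr_gt0 ?expR_gt0//.
have h := z_loc uv.
have := ler_normcD (z u) (z v - z u); rewrite addrC subrK => h2.
rewrite (le_trans h2)// (le_trans (lerD (lexx _) h))//.
by rewrite -/e -[X in X + _]mulr1 -mulrDr ler_wpM2l ?normc_ge0// expR_ge1Dx.
Qed.

(** The phase [z s / |z s|]. Chords between phases replace differences of arguments, so that no
    continuous branch of the argument has to be chosen. *)
Let u s : R[i] := Complex (Re (z s) / normc (z s)) (Im (z s) / normc (z s)).

Local Notation dot s t := (Re (z s) * Re (z t) + Im (z s) * Im (z t)).

(* |z t - z s|^2 = (|z t| - |z s|)^2 + |z s| |z t| |u t - u s|^2 *)
Let normc_u s t : normc (u t - u s) ^+ 2 * (normc (z s) * normc (z t)) =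
  2 * (normc (z s) * normc (z t)) - 2 * dot s t.
Proof.
rewrite normcE2 ReB ImB /=.
have := normcE2 (z s); have := normcE2 (z t).
have : normc (z s) != 0 by rewrite gt_eqF// normc_gt0.
have : normc (z t) != 0 by rewrite gt_eqF// normc_gt0.
move: (normc (z s)) (normc (z t)) (Re (z s)) (Im (z s)) (Re (z t)) (Im (z t)).
move=> ns nt a b c d nt0 ns0 Ht Hs.
transitivity ((c ^+ 2 + d ^+ 2) * ns / nt + (a ^+ 2 + b ^+ 2) * nt / ns -
  2 * (a * c + b * d)).
  by field; rewrite nt0 ns0.
by rewrite -Ht -Hs; field; rewrite nt0 ns0.
Qed.

(** [chain_limit] bounds the chord between the phases by [kappa * |b - a|], and the squared chord is
    2 minus twice the cosine of the angle between [z a] and [z b]. *)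
Lemma chain_dot a b :
  normc (z a) * normc (z b) * (1 - kappa ^+ 2 * (b - a) ^+ 2 / 2) <= dot a b.
Proof.
have nz s : 0 < normc (z s) by exact: normc_gt0.
have H : normc (u b - u a) <= kappa * `|b - a|.
  apply: (chain_limit (D := fun a b => normc (u b - u a))).
    move=> r s t; have -> : u t - u r = (u s - u r) + (u t - u s).
      by rewrite [RHS]addrC addrA subrK.
    exact: ler_normcD.
  move=> s t st; set e := (X in _ <= X).
  have e0 : 0 <= e by rewrite addr_ge0 ?mulr_ge0.
  rewrite -(@ler_pXn2r _ 2) ?nnegrE ?normc_ge0//.
  rewrite -(ler_pM2r (mulr_gt0 (nz s) (nz t))) normc_u.
  apply: (@le_trans _ _ (normc (z t - z s) ^+ 2)).
    rewrite normcE2 ReB ImB.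
    have := normcE2 (z s); have := normcE2 (z t).
    have := sqr_ge0 (normc (z s) - normc (z t)); nra.
  (* The geometric mean of the bounds relative to z s and to z t cancels the
     weight |z s| |z t| exactly. *)
  have st' : `|s - t| <= 1 by rewrite distrC.
  have h1 := z_loc st; have h2 := z_loc st'.
  rewrite normcB [`|s - t|]distrC -/e in h2.
  rewrite -/e in h1.
  rewrite expr2 (le_trans (ler_pM (normc_ge0 _) (normc_ge0 _) h1 h2))//.
  by rewrite le_eqVlt; apply/orP; left; apply/eqP; ring.
have H2 : normc (u b - u a) ^+ 2 <= kappa ^+ 2 * (b - a) ^+ 2.
  rewrite -[(b - a) ^+ 2]real_normK ?num_real// -exprMn.
  by rewrite lerXn2r ?nnegrE ?normc_ge0// mulr_ge0.
have := normc_u a b.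
have := ler_wpM2r (ltW (mulr_gt0 (nz a) (nz b))) H2.
set P := normc (z a) * normc (z b); lra.
Qed.

End Chain.

(** * Complex partial integrals *)

Section ComplexIntegral.
Context (R : realType) (n : nat).
Implicit Types (x y : nat -> R) (G : (nat -> R) -> R) (F : (nat -> R) -> R[i]).
Local Notation Re := complex.Re.
Local Notation Im := complex.Im.

(** Describes the points that an integral over [l] started at [x] can visit; integrands are compared
    only there. *)
Definition agree_off (l : seq nat) x y := forall i, i \notin l -> y i = x i.

Lemma agree_off_upd j l x y s : agree_off l (upd x j s) y ->
  agree_off (j :: l) x y.
Proof.
move=> H i; rewrite inE negb_or => /andP[ij il].
by rewrite H// upd_neq.
Qed.

Lemma eq_rIs l G1 G2 x : (forall y, agree_off l x y -> G1 y = G2 y) ->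
  rIs l G1 x = rIs l G2 x.
Proof.
elim: l x => [|j l IH] x H /=; first exact: H.
by apply: eq_rI => s; apply: IH => y /agree_off_upd; exact: H.
Qed.

Lemma ler_rIs l G1 G2 x : tame n G1 -> tame n G2 ->
  (forall y, agree_off l x y -> G1 y <= G2 y) -> rIs l G1 x <= rIs l G2 x.
Proof.
move=> t1 t2; elim: l x => [|j l IH] x H /=; first exact: H.
apply: (ler_rI (n := n)); [exact: tame_rIs|exact: tame_rIs|] => s.
by apply: IH => y /agree_off_upd; exact: H.
Qed.

Lemma rIs_cst l (a : R) x : rIs l (fun=> a) x = a.
Proof.
by elim: l x => //= j l IH x; rewrite -[RHS](rI_cst j a x); exact: eq_rI.
Qed.

Lemma rIsD l G1 G2 x : tame n G1 -> tame n G2 ->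
  rIs l (fun y => G1 y + G2 y) x = rIs l G1 x + rIs l G2 x.
Proof.
move=> t1 t2; elim: l x => //= j l IH x.
by rewrite -(rID (n := n)); [exact: eq_rI|exact: tame_rIs|exact: tame_rIs].
Qed.

Lemma rIsZ l a G x : tame n G -> rIs l (fun y => a * G y) x = a * rIs l G x.
Proof.
move=> t1; elim: l x => //= j l IH x.
by rewrite -(rIZ (n := n)); [exact: eq_rI|exact: tame_rIs].
Qed.

Lemma rIs_upd l G x j s : j \notin l ->
  rIs l G (upd x j s) = rIs l (fun y => G (upd y j s)) x.
Proof.
elim: l x => //= k l IH x; rewrite inE negb_or => /andP[jk jl].
by apply: eq_Rintegral => t _; rewrite updC// IH.
Qed.

Lemma rIs_swap i j l G x : tame n G ->
  rIs [:: i, j & l] G x = rIs [:: j, i & l] G x.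
Proof. by move=> tG /=; apply: (rI_swap (n := n)); exact: tame_rIs. Qed.

(** Fubini moves [j] to the front. It allows a coordinate chosen anywhere in [l] to be integrated
    last. *)
Lemma rIs_rem j l G x : tame n G -> j \in l ->
  rIs l G x = rIs (j :: rem j l) G x.
Proof.
move=> tG; elim: l x => //= k l IH x; rewrite inE.
have [->//|kj /= jl] := eqVneq k j.
have -> : rI k (rIs l G) x = rIs [:: k, j & rem j l] G x.
  by apply: eq_rI => s; rewrite IH.
exact: rIs_swap.
Qed.

Definition ctame F := tame n (fun x => Re (F x)) /\ tame n (fun x => Im (F x)).

Definition cIs (l : seq nat) F x : R[i] :=
  Complex (rIs l (fun y => Re (F y)) x) (rIs l (fun y => Im (F y)) x).

Lemma ctame_cIs l F : ctame F -> ctame (cIs l F).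
Proof. by case=> t1 t2; split; exact: tame_rIs. Qed.

Lemma ctameD F1 F2 : ctame F1 -> ctame F2 -> ctame (fun x => F1 x + F2 x).
Proof.
move=> [r1 i1] [r2 i2]; split.
  by under eq_fun do rewrite ReD; exact: tameD.
by under eq_fun do rewrite ImD; exact: tameD.
Qed.

Lemma ctameM F1 F2 : ctame F1 -> ctame F2 -> ctame (fun x => F1 x * F2 x).
Proof.
move=> [r1 i1] [r2 i2]; split.
  by under eq_fun do rewrite ReM; apply: tameB; exact: tameM.
by under eq_fun do rewrite ImM; apply: tameD; exact: tameM.
Qed.

Lemma ctame_cst (a : R[i]) : ctame (fun=> a).
Proof. by split; exact: tame_cst. Qed.

Lemma ctameB F1 F2 : ctame F1 -> ctame F2 -> ctame (fun x => F1 x - F2 x).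
Proof.
move=> [r1 i1] [r2 i2]; split.
  by under eq_fun do rewrite ReB; exact: tameB.
by under eq_fun do rewrite ImB; exact: tameB.
Qed.

Lemma ctame_sum (I : Type) (r : seq I) (P : pred I)
    (F : I -> (nat -> R) -> R[i]) :
  (forall i, ctame (F i)) -> ctame (fun x => \sum_(i <- r | P i) F i x).
Proof.
move=> tF; elim: r => [|i r IH].
  by under eq_fun do rewrite big_nil; exact: ctame_cst.
under eq_fun do rewrite big_cons.
by case: (P i); [exact: ctameD|exact: IH].
Qed.

Lemma tame_normc F : ctame F -> tame n (fun x => normc (F x)).
Proof.
move=> [t1 t2]; apply: (tame_dominated t1 t2) => [x|x y].
  by rewrite ger0_norm ?normc_ge0// ler_normc.
rewrite (le_trans (ler_normc_sub _ _))// (le_trans (ler_normc _))//.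
by rewrite ReB ImB.
Qed.

Definition cl1lip (L : R) F :=
  forall x y, normc (F x - F y) <= L * l1dist n x y.

Lemma cl1lip_Re L F : cl1lip L F -> l1lip n L (fun x => Re (F x)).
Proof. by move=> H x y; rewrite -ReB (le_trans (ler_norm_Re _)). Qed.

Lemma cl1lip_Im L F : cl1lip L F -> l1lip n L (fun x => Im (F x)).
Proof. by move=> H x y; rewrite -ImB (le_trans (ler_norm_Im _)). Qed.

Lemma ctame_cl1lip L F : 0 <= L -> cl1lip L F -> ctame F.
Proof.
move=> L0 H; split; first exact: (tame_l1lip L0 (cl1lip_Re H)).
exact: (tame_l1lip L0 (cl1lip_Im H)).
Qed.

Lemma ctame_cexp L F : 0 <= L -> cl1lip L F -> ctame (fun x => cexp (F x)).
Proof.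
move=> L0 H; have tR := tame_expR L0 (cl1lip_Re H).
split; rewrite /cexp /=; apply: (tameM tR); apply: (tame_l1lip L0) => x y.
  by rewrite (le_trans (ler_dist_cos _ _))// cl1lip_Im.
by rewrite (le_trans (ler_dist_sin _ _))// cl1lip_Im.
Qed.

Lemma eq_cIs l F1 F2 x : (forall y, agree_off l x y -> F1 y = F2 y) ->
  cIs l F1 x = cIs l F2 x.
Proof. by move=> H; congr Complex; apply: eq_rIs => y /H ->. Qed.

Lemma cIsD l F1 F2 x : ctame F1 -> ctame F2 ->
  cIs l (fun y => F1 y + F2 y) x = cIs l F1 x + cIs l F2 x.
Proof.
move=> [r1 i1] [r2 i2]; apply: complex_eq; rewrite ?ReD ?ImD /= -rIsD//.
  by apply: eq_rIs => y _; rewrite ReD.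
by apply: eq_rIs => y _; rewrite ImD.
Qed.

Lemma cIs_sum l (I : Type) (r : seq I) (P : pred I)
    (F : I -> (nat -> R) -> R[i]) x :
  (forall i, ctame (F i)) ->
  cIs l (fun y => \sum_(i <- r | P i) F i y) x =
  \sum_(i <- r | P i) cIs l (F i) x.
Proof.
move=> tF; elim: r => [|i r IH].
  rewrite big_nil (@eq_cIs _ _ (fun=> 0)); last by move=> y _; rewrite big_nil.
  by apply: complex_eq; rewrite /= rIs_cst.
rewrite big_cons (@eq_cIs _ _
  (fun y => if P i then F i y + \sum_(j <- r | P j) F j y
            else \sum_(j <- r | P j) F j y));
  last by move=> y _; rewrite big_cons.
by case: (P i) => //; rewrite cIsD// ?IH//; exact: ctame_sum.
Qed.

Lemma cIsZ l a F x : ctame F -> cIs l (fun y => a * F y) x = a * cIs l F x.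
Proof.
move=> [t1 t2]; apply: complex_eq; rewrite ?ReM ?ImM /=.
  rewrite -!rIsZ// -mulN1r -[in RHS]rIsZ; last exact: tameZ.
  rewrite -rIsD; [|exact: tameZ|by apply: tameZ; exact: tameZ].
  by apply: eq_rIs => y _; rewrite ReM mulN1r.
rewrite -!rIsZ// -rIsD; [|exact: tameZ|exact: tameZ].
by apply: eq_rIs => y _; rewrite ImM.
Qed.

(* Integrate the projection of F onto the direction of its integral. *)
Lemma ler_normc_cIs l F x : ctame F ->
  normc (cIs l F x) <= rIs l (fun y => normc (F y)) x.
Proof.
move=> tF; have tN := tame_normc tF; have [t1 t2] := tF.
set z := cIs l F x.
have [->|z0] := eqVneq z 0.
  by rewrite normc0; apply: rIs_ge0 => y; exact: normc_ge0.
rewrite -(ler_pM2l (normc_gt0 z0)) -expr2 normcE2 -rIsZ//.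
have -> : Re z ^+ 2 + Im z ^+ 2 =
    rIs l (fun y => Re z * Re (F y) + Im z * Im (F y)) x.
  by rewrite rIsD ?rIsZ//; exact: tameZ.
apply: ler_rIs; [by apply: tameD; exact: tameZ|exact: tameZ|] => y _.
rewrite (le_trans (ler_norm _))//.
rewrite -(@ler_pXn2r _ 2) ?nnegrE ?mulr_ge0 ?normc_ge0// exprMn !normcE2.
rewrite real_normK ?num_real//.
have := sqr_ge0 (Re z * Im (F y) - Im z * Re (F y)); lra.
Qed.

Lemma cIs_upd l F x j s : j \notin l ->
  cIs l F (upd x j s) = cIs l (fun y => F (upd y j s)) x.
Proof. by move=> jl; rewrite /cIs !rIs_upd. Qed.

Lemma cIs_rem j l F x : ctame F -> j \in l ->
  cIs l F x = cIs (j :: rem j l) F x.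
Proof. by move=> [t1 t2] jl; congr Complex; exact: rIs_rem. Qed.

End ComplexIntegral.

(** * Integrating out one coordinate *)

Section CoordinateStep.
Context (R : realType) (n : nat).
Implicit Types (x y : nat -> R).
Local Notation Re := complex.Re.
Local Notation Im := complex.Im.

Lemma expR1_ge : 5 / 2 <= expR 1 :> R.
Proof.
rewrite [X in expR X](_ : 1 = 8 * (1 / 8)); last by field.
rewrite expRM_natl; apply: (@le_trans _ _ ((9 / 8) ^+ 8)); first lra.
by rewrite lerXn2r ?nnegrE ?expR_ge0//; have := expR_ge1Dx (1 / 8 : R); lra.
Qed.

Lemma expR_half_le : expR (1 / 2) <= 16 / 9 :> R.
Proof.
rewrite [X in expR X](_ : 1 / 2 = 2 * (1 / 4)); last by field.
rewrite expRM_natl; have h : expR (1 / 4) <= 4 / 3 :> R.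
  have := expR_ge1Dx (- (1 / 4) : R); have := expRxMexpNx_1 (1 / 4 : R).
  have := expR_gt0 (1 / 4 : R); nra.
apply: (@le_trans _ _ ((4 / 3) ^+ 2)); last by lra.
by rewrite lerXn2r ?nnegrE ?expR_ge0.
Qed.

(** The tangent of the exponential at 1, with [e >= 5/2]. *)
Lemma ler_id_expR (t : R) : t <= 2 / 5 * expR t.
Proof.
have h := expR_ge1Dx (t - 1); have e := expR1_ge.
have -> : expR t = expR 1 * expR (t - 1) by rewrite -expRD addrC subrK.
have := expR_gt0 (t - 1); nra.
Qed.

(** Apply [ler_id_expR] at [2/5 t] and square. The exponent [4/5] leaves room for the growth
    [expR (1/5 |s|)] of [z] inside [expR |s|]. *)
Lemma ler_sqr_expR (t : R) : 0 <= t -> t ^+ 2 <= expR (4 / 5 * t).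
Proof.
move=> t0; have h := ler_id_expR (2 / 5 * t).
rewrite (_ : 4 / 5 * t = 2 * (2 / 5 * t)); last by field.
by rewrite expRM_natl lerXn2r ?nnegrE ?expR_ge0//; lra.
Qed.

Let expR_coord j (a : R) y := expR (a * y j).

Let tame_expR_coord j a : (j < n)%N -> tame n (expR_coord j a).
Proof.
move=> jn; apply: (@tame_expR _ _ `|a|) => // x y.
rewrite -mulrBr normrM ler_wpM2l//.
by have := l1lip_coord jn x y; rewrite mul1r.
Qed.

Let rI_expR_coord j a x : rI j (expR_coord j a) x = expR (a ^+ 2 / 2).
Proof.
rewrite /rI /Rintegral /expR_coord.
under eq_integral do rewrite updd.
by rewrite gauss1_mgf.
Qed.

(** A majorant of [expR |y j|] whose Gaussian integral is explicit, namely
    [2 expR (1/2) <= 32/9]. *)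
Let cosh2 j y := expR_coord j 1 y + expR_coord j (-1) y.

Let tame_cosh2 j : (j < n)%N -> tame n (cosh2 j).
Proof. by move=> jn; apply: tameD; exact: tame_expR_coord. Qed.

Let rI_cosh2 j x : (j < n)%N -> rI j (cosh2 j) x <= 32 / 9.
Proof.
move=> jn; rewrite (rID (n := n)) ?rI_expR_coord; try exact: tame_expR_coord.
by rewrite sqrrN expr1n; have := expR_half_le; lra.
Qed.

Let cosh2_ge j y : expR `|y j| <= cosh2 j y.
Proof.
rewrite /cosh2 /expR_coord mul1r mulN1r.
have [y0|y0] := leP 0 (y j).
  by rewrite ger0_norm// lerDl expR_ge0.
by rewrite ltr0_norm// lerDr expR_ge0.
Qed.

Variables (Z : (nat -> R) -> R[i]) (j : nat) (x : nat -> R) (kappa : R).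
Hypotheses (tZ : ctame n Z) (jn : (j < n)%N) (kappa_le : kappa <= 1 / 5).
Let z s := Z (upd x j s).
Hypothesis z_neq0 : forall s, z s != 0.
Hypothesis z_norm :
  forall a b, normc (z b) <= normc (z a) * expR (kappa * `|b - a|).
Hypothesis z_dot : forall a b,
  normc (z a) * normc (z b) * (1 - kappa ^+ 2 * (b - a) ^+ 2 / 2) <=
  Re (z a) * Re (z b) + Im (z a) * Im (z b).

Let N := rI j (fun y => normc (Z y)) x.
Let z0 := normc (z 0).

Let z0_gt0 : 0 < z0. Proof. exact: normc_gt0. Qed.

Let tN : tame n (fun y => normc (Z y)). Proof. exact: tame_normc. Qed.

(** [|z s| >= z0 expR (- |s| / 5) >= z0 (1 - |s| / 5)], and [|s|] is at most [2/5 cosh2];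
    integrating leaves [1 - 64/225 >= 7/10]. *)
Let N_ge : z0 * (7 / 10) <= N.
Proof.
apply: (@le_trans _ _ (z0 * rI j (fun y => 1 - 1 / 5 * (2 / 5 * cosh2 j y)) x)).
  rewrite ler_wpM2l ?(ltW z0_gt0)// (rIB (n := n)) ?rI_cst; last 2 first.
  - exact: tame_cst.
  - by do 2! apply: tameZ; exact: tame_cosh2.
  rewrite !(rIZ (n := n)); try by try apply: tameZ; exact: tame_cosh2.
  by have := rI_cosh2 x jn; lra.
rewrite -(rIZ (n := n)); last first.
  by apply: tameB; [exact: tame_cst|do 2! apply: tameZ; exact: tame_cosh2].
apply: (ler_rI (n := n)) => //.
  apply: tameZ; apply: tameB; first exact: tame_cst.
  by do 2! apply: tameZ; exact: tame_cosh2.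
move=> s; have h := z_norm s 0; rewrite -/z0 sub0r normrN in h.
rewrite -ler_pdivrMr ?expR_gt0// -expRN in h.
apply: le_trans h; rewrite ler_wpM2l ?(ltW z0_gt0)//.
rewrite (le_trans _ (expR_ge1Dx _))// lerD2l lerN2.
have := cosh2_ge j (upd x j s); rewrite updd => h1.
have h2 : kappa * `|s| <= 1 / 5 * `|s| by rewrite ler_wpM2r.
have := ler_id_expR `|s|; lra.
Qed.

Lemma coord_integral_gt0 : 0 < N.
Proof. by rewrite (lt_le_trans _ N_ge)// mulr_gt0. Qed.

(* Project the integral of z onto the direction of z 0; the loss is
   kappa^2 / 2 times the second moment of the Gaussian weighted by |z|, which is
   at most 50 / 9 of the total mass. *)
Lemma coord_integral :
  (1 - kappa ^+ 2 * (25 / 9)) * N <= normc (cIs [:: j] Z x).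
Proof.
set I := cIs _ _ _; have [tR tI] := tZ.
pose a := Re (z 0); pose b := Im (z 0).
have Idot : rI j (fun y => a * Re (Z y) + b * Im (Z y)) x = a * Re I + b * Im I.
  by rewrite (rID (n := n)) ?(rIZ (n := n))//; exact: tameZ.
have Ile : a * Re I + b * Im I <= z0 * normc I.
  rewrite (le_trans (ler_norm _))//.
  rewrite -(@ler_pXn2r _ 2) ?nnegrE ?mulr_ge0 ?normc_ge0// exprMn.
  rewrite /z0 !normcE2 real_normK ?num_real// -/a -/b.
  have := sqr_ge0 (a * Im I - b * Re I); lra.
rewrite -(ler_pM2l z0_gt0) (le_trans _ Ile)// -Idot.
pose G y := z0 * normc (Z y) - z0 * (z0 * (kappa ^+ 2 / 2)) * cosh2 j y.
have tG : tame n G.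
  by apply: tameB; apply: tameZ => //; exact: tame_cosh2.
apply: (@le_trans _ _ (rI j G x)).
  rewrite (rIB (n := n)); try (apply: tameZ => //; exact: tame_cosh2).
  rewrite !(rIZ (n := n))//; last exact: tame_cosh2.
  rewrite -/N -[X in _ <= _ - X]mulrA -mulrBr ler_wpM2l ?(ltW z0_gt0)//.
  have := rI_cosh2 x jn; have := N_ge; have := sqr_ge0 kappa; have := z0_gt0.
  set K := kappa ^+ 2; set c := rI j (cosh2 j) x => z00 K0 hN hc.
  (* By [N_ge], [32/9 z0 <= 320/63 N], which is below [50/9 N]. *)
  have h1 : z0 * (K / 2) * c <= z0 * (K / 2) * (32 / 9).
    by rewrite ler_wpM2l// mulr_ge0 ?(ltW z0_gt0)// divr_ge0.
  have h2 : K * (z0 * (7 / 10)) <= K * N by rewrite ler_wpM2l.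
  have h3 : 0 <= K * z0 by rewrite mulr_ge0 ?(ltW z0_gt0).
  lra.
apply: (ler_rI (n := n)) => //; first by apply: tameD; exact: tameZ.
move=> s; have := z_dot 0 s; rewrite -/z0 -/a -/b subr0 => h.
apply: le_trans h; rewrite /G -/(z s).
have h1 : s ^+ 2 * normc (z s) <= z0 * cosh2 j (upd x j s).
  have h2 := z_norm 0 s; rewrite -/z0 subr0 in h2.
  have h3 : expR (kappa * `|s|) <= expR (1 / 5 * `|s|).
    by rewrite ler_expR ler_wpM2r.
  rewrite (le_trans (ler_wpM2l (sqr_ge0 s) h2))// mulrCA.
  rewrite ler_wpM2l ?(ltW z0_gt0)//.
  have := cosh2_ge j (upd x j s); rewrite updd; apply: le_trans.
  have h4 := ler_sqr_expR (normr_ge0 s).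
  rewrite -[s ^+ 2]real_normK ?num_real//.
  rewrite (le_trans (ler_pM (sqr_ge0 _) (expR_ge0 _) h4 h3))// -expRD ler_expR.
  lra.
have h5 : z0 * (kappa ^+ 2 / 2) * (s ^+ 2 * normc (z s)) <=
    z0 * (kappa ^+ 2 / 2) * (z0 * cosh2 j (upd x j s)).
  by rewrite ler_wpM2l// mulr_ge0 ?(ltW z0_gt0)// divr_ge0 ?sqr_ge0.
lra.
Qed.

End CoordinateStep.

(** * Induction on the integrated coordinates *)

Section Induction.
Context (R : realType) (n m : nat).
Implicit Types (x y : nat -> R) (l : seq nat).
Local Notation Re := complex.Re.
Local Notation Im := complex.Im.

Variables (F : 'I_m -> (nat -> R) -> R[i]) (J : 'I_m -> pred nat).
Variables (lambda : R[i]) (c d : nat) (kappa : R).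
Hypothesis F_lip : forall i, cl1lip n 1 (F i).
Hypothesis F_dep :
  forall i x y, (forall j, J i j -> x j = y j) -> F i x = F i y.
Hypothesis J_size : forall i l, uniq l -> (count (J i) l <= d.+1)%N.
Hypothesis J_deg : forall j, (#|[pred i | J i j]| <= c)%N.
Hypotheses (kappa_ge0 : 0 <= kappa) (kappa_le : kappa <= 1 / 5).

(** The factor kept by [coord_integral] for each coordinate integrated out; it equals
    [1 - 1 / (9 d)] once [kappa = 1 / (5 sqrt d)]. *)
Let A : R := 1 - kappa ^+ 2 * (25 / 9).

Hypothesis lambda_le : normc lambda * c%:R <= kappa * A ^+ d.

Let E y : R[i] := lambda * \sum_(i < m) F i y.
Let H y : R[i] := cexp (E y).

Let A_gt0 : 0 < A.
Proof.
have h : kappa ^+ 2 <= (1 / 5) ^+ 2 by rewrite lerXn2r ?nnegrE.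
by rewrite /A; lra.
Qed.

Let A_le1 : A <= 1.
Proof. by rewrite /A; have := sqr_ge0 kappa; lra. Qed.

Let clip_E : cl1lip n (normc lambda * m%:R) E.
Proof.
move=> x y; rewrite /E -mulrBr normcM -mulrA ler_wpM2l ?normc_ge0//.
rewrite -sumrB (le_trans (ler_normc_sum _ _ _))//.
rewrite mulr_natl -[m in leRHS]card_ord -sumr_const.
by apply: ler_sum => i _; have := F_lip i x y; rewrite mul1r.
Qed.

Lemma ctame_cexp_sum : ctame n H.
Proof. by apply: (ctame_cexp _ clip_E); rewrite mulr_ge0 ?normc_ge0. Qed.

Let tH := ctame_cexp_sum.

(* The function g H is integrated at the price of one factor A^-1 for each
   integrated coordinate on which g depends. *)
Let bounded_ratio l := forall (K : pred nat) (g : (nat -> R) -> R[i]) (M : R) x,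
  0 <= M -> ctame n g -> (forall y, normc (g y) <= M) ->
  (forall y y', (forall i, K i || (i \notin l) -> y i = y' i) -> g y = g y') ->
  A ^+ count K l * normc (cIs l (fun y => g y * H y) x) <=
  M * normc (cIs l H x).

Section Increment.
Variables (l : seq nat) (j : nat).
Hypotheses (jl : j \notin l) (ul : uniq l) (br : bounded_ratio l).

Let a : R := normc lambda * c%:R.
Let a_ge0 : 0 <= a. Proof. by rewrite mulr_ge0 ?normc_ge0. Qed.

Let C0 : R := 2 * a ^+ 2 * expR a / A ^+ size l.

Let sum_deg (h : R) :
  \sum_(i < m) (if J i j then h else 0) = h *+ #|[pred i | J i j]|.
Proof. by rewrite -big_mkcond sumr_const. Qed.

Lemma increment_coef_ge0 : 0 <= C0.
Proof.
apply: divr_ge0; last by rewrite exprn_ge0// ltW.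
by rewrite mulr_ge0 ?expR_ge0// mulr_ge0// sqr_ge0.
Qed.

(* With D = E (upd y j t) - E (upd y j s), the linear part of exp D - 1 is a sum
   of functions of at most d coordinates of l each; the remainder involves all
   of l but is quadratic in t - s. *)
Lemma increment_bound x s t : `|t - s| <= 1 ->
  normc (cIs l H (upd x j t) - cIs l H (upd x j s)) <=
  normc (cIs l H (upd x j s)) * (kappa * `|t - s| + C0 * `|t - s| ^+ 2).
Proof.
set x' := upd x j s; set h := `|t - s| => h1.
have h0 : 0 <= h by exact: normr_ge0.
pose g i y := F i (upd y j t) - F i (upd y j s).
have gh i y : normc (g i y) <= if J i j then h else 0.
  case: ifPn => [_|/negP Jij].
    rewrite (le_trans (F_lip i _ _))// mul1r; exact: l1dist_upd.
  rewrite /g (F_dep (y := upd y j s)) ?subrr ?normc0// => k Jk.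
  have kj : k != j by apply/eqP => kj; apply: Jij; rewrite -kj.
  by rewrite !upd_neq.
have gM0 i : 0 <= (if J i j then h else 0 : R) by case: (J i j).
have lipg i : cl1lip n 2 (g i).
  move=> y y'; rewrite /g (_ : _ - _ = (F i (upd y j t) - F i (upd y' j t)) -
     (F i (upd y j s) - F i (upd y' j s))); last by ring.
  rewrite (le_trans (ler_normcD _ _))// normcN mulr2n mulrDl.
  by apply: lerD; rewrite (le_trans (F_lip i _ _))// !mul1r l1dist_upd2.
have tg i : ctame n (g i) by apply: ctame_cl1lip (lipg i).
pose D y := lambda * \sum_(i < m) g i y.
have clipD : cl1lip n (normc lambda * (2 * m%:R)) D.
  move=> y y'; rewrite /D -mulrBr normcM -mulrA ler_wpM2l ?normc_ge0//.
  rewrite -sumrB (le_trans (ler_normc_sum _ _ _))//.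
  rewrite mulrAC mulr_natr -[m in leRHS]card_ord -sumr_const.
  by apply: ler_sum => i _; exact: lipg.
have D0 : 0 <= normc lambda * (2 * m%:R) by rewrite !mulr_ge0 ?normc_ge0.
have tD : ctame n D by exact: ctame_cl1lip clipD.
pose r y := cexp (D y) - 1 - D y.
have tr : ctame n r.
  apply: ctameB => //; apply: ctameB; last exact: ctame_cst.
  exact: ctame_cexp clipD.
have Da y : normc (D y) <= a * h.
  rewrite normcM /a -mulrA ler_wpM2l ?normc_ge0//.
  rewrite (le_trans (ler_normc_sum _ _ _))//.
  apply: (@le_trans _ _ (\sum_(i < m) (if J i j then h else 0))).
    by apply: ler_sum => i _; exact: gh.
  by rewrite sum_deg -[h *+ _]mulr_natl ler_wpM2r// ler_nat.
have rM y : normc (r y) <= 2 * a ^+ 2 * expR a * h ^+ 2.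
  rewrite (le_trans (cexp_approx _))//.
  have -> : 2 * a ^+ 2 * expR a * h ^+ 2 = 2 * (a * h) ^+ 2 * expR a by ring.
  apply: ler_pM; first by apply: mulr_ge0 => //; exact: sqr_ge0.
  - exact: expR_ge0.
  - by rewrite ler_wpM2l// lerXn2r ?nnegrE ?normc_ge0// mulr_ge0.
  - by rewrite ler_expR (le_trans (Da y))// ler_piMr.
have zt : cIs l H (upd x j t) =
  cIs l H x' + (\sum_(i < m) lambda * cIs l (fun y => g i y * H y) x' +
                cIs l (fun y => r y * H y) x').
  rewrite -(upd_upd x j s) cIs_upd//.
  rewrite (@eq_cIs _ _ _
    (fun y => H y + (\sum_(i < m) lambda * (g i y * H y) + r y * H y))).
    rewrite (cIsD (n := n))//; last first.
      apply: ctameD; last exact: ctameM.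
      by apply: ctame_sum => i; apply: ctameM; [exact: ctame_cst|exact: ctameM].
    rewrite (cIsD (n := n))//; last 2 first.
    - by apply: ctame_sum => i; apply: ctameM; [exact: ctame_cst|exact: ctameM].
    - exact: ctameM.
    rewrite (cIs_sum (n := n)); last first.
      by move=> i; apply: ctameM; [exact: ctame_cst|exact: ctameM].
    congr (_ + (_ + _)); apply: eq_bigr => i _.
    by apply: cIsZ; exact: ctameM.
  (* As [j] is not integrated, every visited point already has [s] at [j], so the increments are
     taken from [y] itself. *)
  move=> y yx; have yj : upd y j s = y.
    apply/funext => k; rewrite /upd; case: eqP => // ->.
    by rewrite (yx _ jl) updd.
  have -> : H (upd y j t) = H y * cexp (D y).
    rewrite /H -cexpD; congr cexp; rewrite /E /D -mulrDr -big_split.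
    by congr (_ * _); apply: eq_bigr => i _; rewrite /= /g yj addrC subrK.
  under eq_bigr do rewrite mulrA.
  rewrite -mulr_suml -mulr_sumr -/(D y) /r; ring.
set Z := normc (cIs l H x').
have Z0 : 0 <= Z by exact: normc_ge0.
have Ad : 0 < A ^+ d by rewrite exprn_gt0.
have bg i : normc (cIs l (fun y => g i y * H y) x') * A ^+ d <=
    (if J i j then h else 0) * Z.
  have /br P : 0 <= (if J i j then h else 0 : R) by [].
  have {}P := P (J i) (g i) x' (tg i) (gh i).
  have {}P : A ^+ count (J i) l * normc (cIs l (fun y => g i y * H y) x') <=
      (if J i j then h else 0) * Z.
    apply: P => y y' yy'; rewrite /g.
    by congr (_ - _); apply: F_dep => k Jk; rewrite /upd; case: eqP => // _;
      apply: yy'; rewrite Jk.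
  have [Jij|/negbTE Jij] := boolP (J i j); rewrite Jij in P *.
    apply: le_trans P; rewrite mulrC ler_wpM2r ?normc_ge0//.
    apply: ler_wiXn2l; [exact: ltW|exact: A_le1|].
    (* [j] belongs to [J i] but not to [l], so at most [d] of the [d.+1] coordinates of [J i] are
       integrated: the source of [r - 1] in the radius. *)
    by have := @J_size i (j :: l); rewrite /= Jij jl ul add1n ltnS; apply.
  rewrite mul0r in P *; rewrite pmulr_rle0 ?exprn_gt0// in P.
  by rewrite pmulr_lle0.
have S1 : \sum_(i < m) normc (lambda * cIs l (fun y => g i y * H y) x') <=
    kappa * h * Z.
  rewrite -(ler_pM2r Ad) mulr_suml.
  apply: (@le_trans _ _
    (\sum_(i < m) normc lambda * ((if J i j then h else 0) * Z))).
    by apply: ler_sum => i _; rewrite normcM -mulrA ler_wpM2l ?normc_ge0.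
  rewrite -mulr_sumr -mulr_suml sum_deg.
  apply: (@le_trans _ _ ((normc lambda * c%:R) * (h * Z))).
    rewrite -[leRHS]mulrA ler_wpM2l ?normc_ge0// mulrA ler_wpM2r//.
    by rewrite -[h *+ _]mulr_natl ler_wpM2r// ler_nat.
  have -> : kappa * h * Z * A ^+ d = (kappa * A ^+ d) * (h * Z) by ring.
  by rewrite ler_wpM2r// mulr_ge0.
have S2 : normc (cIs l (fun y => r y * H y) x') <= C0 * h ^+ 2 * Z.
  have As : 0 < A ^+ size l by rewrite exprn_gt0.
  rewrite -(ler_pM2l As).
  have -> : A ^+ size l * (C0 * h ^+ 2 * Z) = 2 * a ^+ 2 * expR a * h ^+ 2 * Z.
    by rewrite /C0; field; rewrite gt_eqF.
  rewrite -(count_predT l); apply: (@br predT r _ x' _ tr rM).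
    by rewrite mulr_ge0 ?sqr_ge0// mulr_ge0 ?expR_ge0// mulr_ge0// sqr_ge0.
  by move=> y y' yy'; congr r; apply/funext => k; exact: yy'.
rewrite zt addrC addKr (le_trans (ler_normcD _ _))// mulrDr.
rewrite mulrC [Z * (C0 * _)]mulrC; apply: lerD => //.
by rewrite (le_trans (ler_normc_sum _ _ _)).
Qed.

End Increment.

(** Along [x j], [increment_bound] gives the local estimate, [chain_norm] and [chain_dot] make it
    global, and [coord_integral] turns it into the loss [A]. Both halves of the induction use
    this. *)
Lemma bounded_ratio_cons l j : uniq l -> j \notin l -> (j < n)%N ->
  (forall x, cIs l H x != 0) -> bounded_ratio l ->
  forall x, 0 < rI j (fun y => normc (cIs l H y)) x /\
    A * rI j (fun y => normc (cIs l H y)) x <= normc (cIs (j :: l) H x).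
Proof.
move=> ul jl jn nz br x.
have inc := increment_bound jl ul br.
have zz s : cIs l H (upd x j s) != 0 by exact: nz.
have c0 := increment_coef_ge0 l.
have zn := chain_norm c0 zz (inc x).
have zd := chain_dot kappa_ge0 c0 zz (inc x).
have tZ := ctame_cIs l tH.
split; first exact: (coord_integral_gt0 tZ jn kappa_le zz zn).
exact: (coord_integral tZ jn kappa_le zz zn zd).
Qed.

(** The induction is on the size of [l], not on its structure, because the ratio bound removes a
    coordinate from the middle of the list. *)
Lemma nonzero_bounded_ratio l : uniq l -> all (fun j => j < n)%N l ->
  (forall x, cIs l H x != 0) /\ bounded_ratio l.
Proof.
have [k] := ubnP (size l); elim: k l => // k IH l lk ul ln.
split.
  case: l lk ul ln => [|j l] lk ul ln x.
    by rewrite (_ : cIs _ _ _ = H x) ?cexp_neq0//; apply: complex_eq.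
  move: ul ln => /= /andP[jl ul] /andP[jn ln].
  have [nz br] := IH l lk ul ln.
  have [N0 NI] := bounded_ratio_cons ul jl jn nz br x.
  apply/eqP => z0; have : 0 < normc (cIs (j :: l) H x).
    by rewrite (lt_le_trans _ NI)// mulr_gt0.
  by rewrite z0 normc0 ltxx.
move=> K g M x M0 tg gM gdep.
(* If [K] misses [l], then [g] is constant during the integration. Otherwise some [j] in [K] is
   integrated last: for the inner integral it is a free coordinate, and the count of [K] drops by
   one. *)
have [/hasP[j jl Kj]|nK] := boolP (has K l); last first.
  rewrite (@eq_cIs _ l _ (fun y => g x * H y)); last first.
    move=> y yx; congr (_ * _); apply: gdep => i /orP[Ki|/yx//].
    apply: yx; apply: contra nK => il; apply/hasP; by exists i.
  rewrite (cIsZ (n := n))// normcM.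
  move: nK; rewrite has_count lt0n negbK => /eqP ->.
  by rewrite expr0 mul1r ler_wpM2r ?normc_ge0.
have ul' : uniq (rem j l) by exact: rem_uniq.
have jl' : j \notin rem j l by rewrite mem_rem_uniqF.
have jn : (j < n)%N by exact: (allP ln).
have ln' : all (fun j => j < n)%N (rem j l).
  by apply/allP => i /mem_rem il; exact: (allP ln).
have lk' : (size (rem j l) < k)%N.
  by rewrite size_rem// -ltnS prednK//; case: (l) jl.
have [nz br] := IH _ lk' ul' ln'.
have [N0 NI] := bounded_ratio_cons ul' jl' jn nz br x.
have tgH : ctame n (fun y => g y * H y) by exact: ctameM.
rewrite !(cIs_rem (n := n) _ _ jl)//.
have -> : count K l = (count K (rem j l)).+1.
  have /permP/(_ K) -> := perm_to_rem jl; by rewrite /= Kj add1n.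
set l' := rem j l in ul' jl' ln' lk' nz br N0 NI *.
(* Take the modulus inside the integral over [j], apply the smaller case for each value of that
   coordinate, and pay the remaining factor [A] with [NI]. *)
apply: (@le_trans _ _ (A ^+ (count K l').+1 *
    rI j (fun y => normc (cIs l' (fun y => g y * H y) y)) x)).
  rewrite ler_wpM2l ?exprn_ge0 ?(ltW A_gt0)//.
  exact: (@ler_normc_cIs _ n [:: j] (cIs l' (fun y => g y * H y)) x
    (ctame_cIs l' tgH)).
apply: (@le_trans _ _
  (M * (A * rI j (fun y => normc (cIs l' H y)) x))); last first.
  by rewrite ler_wpM2l.
have tN := tame_normc (ctame_cIs l' tH).
have tN' := tame_normc (ctame_cIs l' tgH).
rewrite exprS -mulrA [leRHS]mulrCA ler_wpM2l ?(ltW A_gt0)//.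
rewrite -!(rIZ (n := n))//.
apply: (ler_rI (n := n)); [exact: tameZ|exact: tameZ|] => s.
apply: br => // y y' yy'; apply: gdep => i /orP[Ki|il]; apply: yy'.
  by rewrite Ki.
by apply/orP; right; apply: contra il; exact: mem_rem.
Qed.

(** Above, the modulus goes inside the integral. Below, the ratio bound is used with [K = predT], so
    every coordinate of [l] costs one [A], and [|H| >= expR (- B)] gives the rest. *)
Lemma cIs_cexp_bounds l x (L : R) : uniq l -> all (fun j => j < n)%N l ->
  (forall i y, normc (F i y) <= L) ->
  normc (cIs l H x) <= expR (normc lambda * m%:R * L) /\
  expR (- (normc lambda * m%:R * L)) * A ^+ size l <= normc (cIs l H x).
Proof.
move=> ul ln FL; set B := normc lambda * m%:R * L.
have EB y : normc (E y) <= B.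
  rewrite /B /E normcM -mulrA ler_wpM2l ?normc_ge0//.
  rewrite (le_trans (ler_normc_sum _ _ _))//.
  rewrite mulr_natl -[m in leRHS]card_ord -sumr_const.
  by apply: ler_sum => i _; exact: FL.
have HB y : expR (- B) <= expR (Re (E y)) <= expR B.
  by rewrite !ler_expR -ler_norml (le_trans (ler_norm_Re _)).
split.
  rewrite (le_trans (ler_normc_cIs _ _ tH))// -[leRHS](rIs_cst l _ x).
  apply: (ler_rIs (n := n)); [exact: tame_normc|exact: tame_cst|] => y _.
  by rewrite normc_cexp; case/andP: (HB y).
(* The phase g turns H into |H|. *)
pose g y : R[i] := cexp (Complex 0 (- Im (E y))).
have clip_g : cl1lip n (normc lambda * m%:R) (fun y => Complex 0 (- Im (E y))).
  move=> y y'; apply: le_trans (clip_E y y').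
  rewrite (le_trans (ler_normc _))//= subrr normr0 add0r.
  by rewrite distrC opprK addrC -ImB ler_norm_Im.
have tg : ctame n g.
  by apply: (ctame_cexp _ clip_g); rewrite mulr_ge0 ?normc_ge0.
have g1 y : normc (g y) <= 1 by rewrite normc_cexp /= expR0.
have gH y : g y * H y = Complex (expR (Re (E y))) 0.
  rewrite /g /H -cexpD [X in cexp X](_ : _ = Complex (Re (E y)) 0).
    by apply: complex_eq; rewrite /= ?cos0 ?sin0 ?mulr1 ?mulr0.
  by apply: complex_eq; rewrite ?ReD ?ImD /= ?add0r ?addNr.
have [_ br] := nonzero_bounded_ratio ul ln.
have {br} := br predT g 1 x ler01 tg g1; rewrite mul1r count_predT => br.
apply: le_trans (br _); last first.
  by move=> y y' yy'; congr g; apply/funext => k; exact: yy'.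
rewrite mulrC ler_wpM2l ?exprn_ge0 ?(ltW A_gt0)//.
apply: le_trans (ler_norm_Re _); rewrite (le_trans _ (ler_norm _))//.
rewrite -[leLHS](rIs_cst l _ x).
have tgH : ctame n (fun y => g y * H y) by exact: ctameM.
apply: (ler_rIs (n := n) (G2 := fun y => Re (g y * H y))) => [||y _];
  [exact: tame_cst|by case: tgH|].
by rewrite gH; case/andP: (HB y).
Qed.

End Induction.

(** * Numerical constants *)

Section Constants.
Context (R : realType).

(** The quadratic lower bound of the cosine at its zero [pi / 2]. *)
Lemma sqr_pi_ge8 : 8 <= pi ^+ 2 :> R.
Proof.
have := cos_ge1B (pi / 2 : R); rewrite cos_pihalf; lra.
Qed.

Lemma bernoulli_inequality (a : R) (k : nat) :
  0 <= a <= 1 -> 1 - k%:R * a <= (1 - a) ^+ k.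
Proof.
move=> /andP[a0 a1]; elim: k => [|k IH]; first by rewrite expr0 mul0r subr0.
rewrite exprS -natr1; have k0 : 0 <= k%:R * a ^+ 2 by rewrite mulr_ge0 ?sqr_ge0.
have := ler_wpM2l (_ : 0 <= 1 - a) IH; rewrite subr_ge0 => /(_ a1); lra.
Qed.

(** Compares the stated loss per coordinate with [A]. By [pi^2 >= 8] the left side is at most
    [1 - 1 / (4 d + 5)], and [4 d + 5 <= 9 d] exactly when [d >= 1]. *)
Lemma expR_pi_le (d : nat) : (0 < d)%N ->
  expR (- (pi ^+ 2 / (32 * d.+1%:R))) <= 1 - 1 / (9 * d%:R) :> R.
Proof.
move=> d0; have d1 : 1 <= d%:R :> R by rewrite ler1n.
set y := pi ^+ 2 / _.
have y1 : 1 / (4 * d.+1%:R) <= y.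
  rewrite /y -[d.+1%:R]natr1 ler_pdivrMr; last by lra.
  rewrite mulrAC ler_pdivlMr; last by lra.
  have := sqr_pi_ge8; nra.
have e1 : 1 + 1 / (4 * d.+1%:R) <= expR y.
  by rewrite (le_trans _ (expR_ge1Dx y))// lerD2l.
rewrite expRN; apply: (@le_trans _ _ (1 + 1 / (4 * d.+1%:R))^-1).
  by rewrite lef_pV2 ?posrE ?expR_gt0// ltr_wpDr ?divr_ge0.
rewrite -[d.+1%:R]natr1; move: d%:R d1 => {y y1 e1} D D1.
have -> : (1 + 1 / (4 * (D + 1)))^-1 = (4 * D + 4) / (4 * D + 5).
  by field; lra.
have -> : 1 - 1 / (9 * D) = (9 * D - 1) / (9 * D) by field; lra.
rewrite ler_pdivrMr; last by lra.
rewrite mulrAC ler_pdivlMr; last by lra.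
lra.
Qed.

End Constants.

(** * The expectation as an iterated integral, and the final bounds *)

(** The integrals of both parts are found to be real numbers, so [fine] hides no infinite value. The
    base point 0 is arbitrary: all coordinates below [n] are overwritten. *)
Lemma gauss_expectation_cIs (R : realType) (n : nat) (g : n.-tuple R -> R[i]) :
  ctame n (fun x => g [tuple x j | j < n]) ->
  gauss_expectation g =
  cIs (iota 0 n) (fun x => g [tuple x j | j < n]) (fun=> 0).
Proof.
move=> [tR tI].
have tupE (t : n.-tuple R) : [tuple splice (fun=> 0) 0 t j | j < n] = t.
  apply: eq_from_tnth => j; rewrite tnth_mktuple /splice size_tuple add0n /=.
  by rewrite ltn_ord subn0 -tnth_nth.
have [_ eR] := integral_gauss_prob n 0 (fun=> 0) tR.
have [_ eI] := integral_gauss_prob n 0 (fun=> 0) tI.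
rewrite /gauss_expectation /cIs !unlock; congr Complex.
  rewrite -[RHS]/(fine (_%:E)) -eR; congr fine.
  by apply: eq_integral => t _; rewrite tupE.
rewrite -[RHS]/(fine (_%:E)) -eI; congr fine.
by apply: eq_integral => t _; rewrite tupE.
Qed.

Theorem theorem1p2 (R : realType) (n m r c : nat)
    (phi : 'I_m -> n.-tuple R -> R[i]) (lambda : R[i]) :
  (2 <= r)%N -> (1 <= c)%N ->
  (forall (i : 'I_m) (x y : n.-tuple R),
     normc (phi i x - phi i y) <= \sum_(j < n) `|tnth x j - tnth y j|) ->
  (exists J : 'I_m -> {set 'I_n},
     [/\ forall i, (#|J i| <= r)%N,
         forall j, (#|[pred i | j \in J i]| <= c)%N
       & forall i, depends_only_on (J i) (phi i)]) ->
  normc lambda < 1 / (6 * c%:R * Num.sqrt (r%:R - 1)) ->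
  let f := fun x : n.-tuple R => \sum_(i < m) phi i x in
  let Eexp := gauss_expectation (fun x => cexp (lambda * f x)) in
  Eexp <> 0 /\
  (forall L : R, 0 < L ->
     (forall (i : 'I_m) (x : n.-tuple R), normc (phi i x) <= L) ->
     expR (normc lambda * m%:R * L) >= normc Eexp /\
     normc Eexp >= expR (- (normc lambda * m%:R * L)) *
                   expR (- (pi ^+ 2 * n%:R / (32 * r%:R)))).
Proof.
move=> r2 c1 phi_lip [J [J_r J_c phi_dep]] lambda_lt f Eexp.
(* From here on [r = d.+1], so that [d] is [r - 1]. *)
case: r r2 J_r lambda_lt => // d d1 J_r lambda_lt.
have {d1} d0 : (0 < d)%N by [].
have dR : 1 <= d%:R :> R by rewrite ler1n.
have cR : 1 <= c%:R :> R by rewrite ler1n.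
pose tup (x : nat -> R) : n.-tuple R := [tuple x j | j < n].
pose F i x := phi i (tup x).
pose J' i : pred nat := fun k => k \in [seq val j | j in J i].
have F_lip i : cl1lip n 1 (F i).
  move=> x y; rewrite mul1r (le_trans (phi_lip _ _ _))//.
  by apply: ler_sum => j _; rewrite !tnth_mktuple.
have F_dep i x y : (forall j, J' i j -> x j = y j) -> F i x = F i y.
  move=> xy; apply: phi_dep => j jJ; rewrite !tnth_mktuple; apply: xy.
  by apply/mapP; exists j; rewrite ?mem_enum.
have J_size i l : uniq l -> (count (J' i) l <= d.+1)%N.
  move=> ul; rewrite (leq_trans _ (J_r i))// -size_filter cardE.
  rewrite -(size_map val) uniq_leq_size ?filter_uniq// => k.
  by rewrite mem_filter => /andP[].
have J_deg j : (#|[pred i | J' i j]| <= c)%N.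
  have [jn|nj] := ltnP j n.
    rewrite (leq_trans _ (J_c (Ordinal jn)))// subset_leq_card//.
    apply/fintype.subsetP => i; rewrite !inE => /mapP[k].
    rewrite mem_enum => kJ jk.
    by rewrite (_ : Ordinal jn = k)//; apply: val_inj.
  rewrite (@eq_card0 _ _)// => i; rewrite !inE; apply/negP => /mapP[k _ jk].
  by move: nj; rewrite jk leqNgt ltn_ord.
pose q : R := Num.sqrt d%:R.
have q2 : q ^+ 2 = d%:R by rewrite sqr_sqrtr.
have q1 : 1 <= q by rewrite -sqrtr1 ler_sqrt.
(* kappa is fixed so that A^d >= 8/9, and 1/6 <= (1/5)(8/9) closes the
   induction. *)
pose kappa : R := 1 / (5 * q).
have k0 : 0 <= kappa by rewrite divr_ge0// mulr_ge0// sqrtr_ge0.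
have k1 : kappa <= 1 / 5.
  by rewrite /kappa !div1r lef_pV2 ?posrE; lra.
pose A : R := 1 - kappa ^+ 2 * (25 / 9).
have AE : A = 1 - 1 / (9 * d%:R).
  rewrite /A /kappa -q2; field.
  by lra.
(* Bernoulli: [(1 - 1 / (9 d))^d >= 1 - d / (9 d)], uniformly in [d]. *)
have A89 : 8 / 9 <= A ^+ d.
  rewrite AE; apply: le_trans (bernoulli_inequality d _); last first.
    have Dp : 0 < 9 * d%:R :> R by lra.
    by rewrite divr_ge0 ?(ltW Dp)//= ler_pdivrMr// mul1r; lra.
  rewrite le_eqVlt; apply/orP; left; apply/eqP; field; lra.
have lambda_le : normc lambda * c%:R <= kappa * A ^+ d.
  have q0 : 0 < 6 * c%:R * q by rewrite !mulr_gt0//; lra.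
  move: lambda_lt; rewrite -[d.+1%:R]natr1 addrK -/q ltr_pdivlMr// => h.
  have k89 : kappa * (8 / 9) <= kappa * A ^+ d by rewrite ler_wpM2l.
  apply: le_trans k89; rewrite /kappa mulrAC ler_pdivlMr; last by lra.
  by lra.
have EE : Eexp =
    cIs (iota 0 n) (fun x => cexp (lambda * \sum_(i < m) F i x)) (fun=> 0).
  apply: gauss_expectation_cIs.
  exact: (ctame_cexp_sum lambda F_lip).
have ul : uniq (iota 0 n) by exact: iota_uniq.
have ln : all (fun j => j < n)%N (iota 0 n).
  by apply/allP => j; rewrite mem_iota.
split.
  have [nz _] := nonzero_bounded_ratio
    F_lip F_dep J_size J_deg k0 k1 lambda_le ul ln.
  by rewrite EE; exact/eqP/nz.
move=> L L0 phi_L.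
have [ub lb] := cIs_cexp_bounds F_lip F_dep J_size J_deg k0 k1 lambda_le
  (fun=> 0) ul ln (fun i y => phi_L i (tup y)).
rewrite EE; split => //.
apply: le_trans lb; rewrite ler_wpM2l ?expR_ge0// size_iota -/A AE.
rewrite (_ : - _ = n%:R * - (pi ^+ 2 / (32 * d.+1%:R))); last first.
  by rewrite mulrN mulrCA mulrA.
rewrite expRM_natl lerXn2r ?nnegrE ?expR_ge0 ?expR_pi_le//.
by rewrite (le_trans _ (expR_pi_le R d0))// expR_ge0.
Qed.
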